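(* Let $K$ be an infinite field of characteristic $p>0$ and let $\lambda=(\lambda_1,\dots,\lambda_n)$, $\mu=(\mu_1,\dots,\mu_n)$ be partitions of $r$ with at most $n$ parts such that $\mu_2\le\lambda_1$. Suppose $k,d$ are nonnegative integers such that $p^d>\min\{\lambda_2,\ \mu_1-\lambda_1\}$. Then \[\dim_K\operatorname{Hom}_S(\Delta(\lambda),\Delta(\mu))=\dim_K\operatorname{Hom}_{S'}(\Delta(\lambda^+),\Delta(\mu^+)),\] where $S=S_K(n,r)$, $S'=S_K(n,r+kp^d)$, $\lambda^+=(\lambda_1+kp^d,\lambda_2,\dots,\lambda_n)$ and $\mu^+=(\mu_1+kp^d,\mu_2,\dots,\mu_n)$.
   Context: $S_K(n,r)$ denotes the Schur algebra, whose modules are the homogeneous polynomial representations of degree $r$ of $GL_n(K)$. For a partition $\nu$ of $r$ with at most $n$ parts, $\Delta(\nu)$ denotes the Weyl module of highest weight $\nu$ for $S_K(n,r)$ (in the Akin–Buchsbaum–Weyman construction, the image of the map $d'_\nu: D_{\nu_1}V\otimes\cdots\otimes D_{\nu_n}V\to \Lambda^{\nu^t_1}V\otimes\cdots\otimes\Lambda^{\nu^t_{\nu_1}}V$, where $V=K^n$, $D$ denotes divided powers and $\nu^t$ is the transpose partition). *)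

(* Defs.v *)
From HB Require Import structures.
From mathcomp Require Import all_boot all_order all_algebra.
Unset Printing Implicit Defensive.
Import Order.TTheory GRing.Theory Num.Theory.
Local Open Scope ring_scope.

Section Weyl.
Variable K : fieldType.
Variable n : nat.

(* A partition nu = (nu_1,...,nu_n) is a seq nat of size n; nu_i = nth 0 nu (i-1). *)
Definition ncols (nu : seq nat) : nat := nth 0%N nu 0.

(* Index type of the standard basis of
   Lambda^{a_1} V (x) ... (x) Lambda^{a_m} V  (m = nu_1 columns):
   S : 'I_m -> {set 'I_n}, basis vector e_{S 1} (x) ... (x) e_{S m},
   where e_A = e_{a_1} /\ ... /\ e_{a_k} for A = {a_1 < ... < a_k}.
   (Indices S with #|S j| <> nu^t_j carry the other tensor products of
   exterior powers; the Weyl module lies in the summand with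
   #|S j| = nu^t_j.) *)
Definition tidx (nu : seq nat) := {ffun 'I_(ncols nu) -> {set 'I_n}}.

Definition amb (nu : seq nat) := {ffun tidx nu -> K^o}.

Definition minor (g : 'M[K]_n) (S T : {set 'I_n}) : K :=
  if #|S| == #|T| then
    let rows := [seq [seq g a b | b <- enum T] | a <- enum S] in
    \det (\matrix_(i < #|S|, j < #|S|) nth 0 (nth [::] rows i) j)
  else 0.

(* action of g in GL_n(K) on Lambda^{a_1}V (x) ... (x) Lambda^{a_m}V :
   g.(v_1/\../\v_k) = g v_1 /\ ... /\ g v_k, factorwise *)
Definition act (nu : seq nat) (g : 'M[K]_n) (w : amb nu) : amb nu :=
  [ffun S : tidx nu => \sum_(T : tidx nu)
      (\prod_(j < ncols nu) minor g (S j) (T j)) * w T].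

Definition inversions (w : seq 'I_n) : nat :=
  let w' := map val w in
  (\sum_(i < size w) \sum_(j < size w | (i < j)%N)
     (nth 0%N w' j < nth 0%N w' i)%N)%N.

(* coefficient of e_{set of w} in w_1 /\ ... /\ w_k *)
Definition wedge_coef (w : seq 'I_n) : K :=
  if uniq w then (-1) ^+ inversions w else 0.

Definition cellP (nu : seq nat) (c : 'I_n * 'I_(ncols nu)) : bool :=
  (c.2 < nth 0%N nu c.1)%N.
Definition cells (nu : seq nat) := {c : 'I_n * 'I_(ncols nu) | cellP nu c}.

Definition filling (nu : seq nat) := {ffun cells nu -> 'I_n}.

Definition roww (nu : seq nat) (F : filling nu) (i : 'I_n) : seq 'I_n :=
  [seq F c | c <- enum [set: cells nu] & (val c).1 == i].
Definition colw (nu : seq nat) (F : filling nu) (j : 'I_(ncols nu)) : seq 'I_n :=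
  [seq F c | c <- enum [set: cells nu] & (val c).2 == j].

(* the tensor  (x)_j (F(1,j) /\ F(2,j) /\ ... /\ F(nu^t_j, j)) *)
Definition fvec (nu : seq nat) (F : filling nu) : amb nu :=
  [ffun S : tidx nu => \prod_(j < ncols nu)
      (if [set x in colw nu F j] == S j then wedge_coef (colw nu F j) else 0)].

Definition rowequiv (nu : seq nat) (F F' : filling nu) : bool :=
  [forall i : 'I_n, perm_eq (roww nu F i) (roww nu F' i)].

(* d'_nu applied to the basis vector x^{(alpha_1)} (x) ... (x) x^{(alpha_n)}
   of D_{nu_1}V (x) ... (x) D_{nu_n}V, where alpha_i = content of row i of F:
   diagonalize each divided power into V^{(x) nu_i} (sum of all distinct
   words with content alpha_i), then multiply along columns into
   Lambda^{nu^t_1}V (x) ... (x) Lambda^{nu^t_{nu_1}}V. *)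
Definition dprime_basis (nu : seq nat) (F : filling nu) : amb nu :=
  \sum_(F' : filling nu | rowequiv nu F F') fvec nu F'.

Definition Weyl (nu : seq nat) : {vspace amb nu} :=
  <<[seq dprime_basis nu F | F <- enum (filling nu)]>>%VS.

(* Hom_{S_K(n,r)}(Delta(la), Delta(mu)): linear maps commuting with the
   action of GL_n(K) (for K infinite, S_K(n,r)-module maps between
   polynomial GL_n-modules of degree r are exactly these). *)
Definition is_Shom (la mu : seq nat)
    (f : 'Hom(subvs_of (Weyl la), subvs_of (Weyl mu))) : Prop :=
  forall g : 'M[K]_n, g \in unitmx ->
  forall (u v : subvs_of (Weyl la)),
    vsval v = act la g (vsval u) -> vsval (f v) = act mu g (vsval (f u)).

End Weyl.

Definition has_dim (K : fieldType) (vT : vectType K) (P : vT -> Prop) (d : nat) : Prop :=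
  exists X : d.-tuple vT,
    [/\ free X, (forall x, x \in X -> P x) & (forall v, P v -> v \in <<X>>%VS)].

Definition dimHom_is (K : fieldType) (n : nat) (la mu : seq nat) (d : nat) : Prop :=
  has_dim K _ (is_Shom K n la mu) d.

Definition is_partition (n r : nat) (nu : seq nat) : bool :=
  [&& size nu == n, sorted geq nu & sumn nu == r].

Definition plus_first (a : nat) (nu : seq nat) : seq nat :=
  (nth 0 nu 0 + a)%N :: behead nu.

(* Main.v *)
(** Evaluation at the highest weight vector z of Delta(la) identifies
    Hom(Delta(la), Delta(mu)) with the space of primitive vectors of weight la
    in Delta(mu), i.e. those fixed by the matrices 1 + E_{i,i+1}.  Surjectivity is
    the universal property of Delta(la): if v is primitive, every coordinate of
    g v is a polynomial in the entries of g which is homogeneous of degree la_i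
    in column i and invariant under right multiplication by unipotent upper
    triangular matrices, and such a polynomial is a combination of the
    coordinates of g z, which are products of minors.  Indeed its leading
    monomial is the row content of a semistandard tableau (a Garnir relation,
    see [lead_semistandard]), and the product of the minors given by the columns
    of that tableau has the same leading monomial, with coefficient 1.

    With N = k p^d, taking the component e_1 (x) ... (x) e_1 in the last N columns
    defines a linear map phi from Delta(mu^+) to Delta(mu).  As mu_2 <= la_1, it is
    bijective between the weight spaces la^+ and la: injectivity follows from the
    relation that the exterior product of any column with a column of length one
    kills Delta(mu^+).  Finally phi commutes with 1 + E_{i,i+1} on the weight space
    la^+; the only obstruction, for i = 1, is multiplied by binomial(N, s) for
    some s with 1 <= s <= min(la_2, mu_1 - la_1) < p^d, and so vanishes in K. *)

Require Import Defs.
From HB Require Import structures.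
From mathcomp Require Import all_boot all_order all_algebra fingroup perm.
From mathcomp Require Import zify.
From mathcomp Require Import mpoly.
Set Implicit Arguments.
Unset Strict Implicit.
Unset Printing Implicit Defensive.
Import Order.TTheory GRing.Theory Num.Theory.
Local Open Scope ring_scope.

(** * Minors and the Cauchy-Binet formula *)

Section CauchyBinet.
Variable R : comNzRingType.

(** Multilinearity in the rows: row [i] of [A *m B] is the combination of the rows of [B] with
    coefficients [A i a]. *)
Lemma det_mul_words k n (A : 'M[R]_(k, n)) (B : 'M[R]_(n, k)) :
  \det (A *m B) = \sum_(f : {ffun 'I_k -> 'I_n})
     (\prod_i A i (f i)) * \det (\matrix_(i, j) B (f i) j).
Proof.
rewrite /determinant.
under [RHS]eq_bigr do rewrite mulr_sumr.
rewrite exchange_big /=; apply: eq_bigr => s _.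
under eq_bigr do rewrite mxE.
rewrite bigA_distr_bigA mulr_sumr; apply: eq_bigr => f _.
rewrite big_split /= mulrCA; congr (_ * (_ * _)).
by apply: eq_bigr => i _; rewrite mxE.
Qed.

Definition setnth n (x0 : 'I_n) (U : {set 'I_n}) k (i : 'I_k) := nth x0 (enum U) i.

Lemma setnth_inj n (x0 : 'I_n) (U : {set 'I_n}) k :
  #|U| = k -> injective (@setnth n x0 U k).
Proof.
move=> cU i j /eqP; rewrite /setnth nth_uniq ?enum_uniq -?cardE ?cU //.
by move/eqP/val_inj.
Qed.

Lemma mem_setnth n (x0 : 'I_n) (U : {set 'I_n}) k (i : 'I_k) :
  #|U| = k -> setnth x0 U i \in U.
Proof. by move=> cU; rewrite -mem_enum mem_nth // -cardE cU. Qed.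

Lemma setnth_onto n (x0 : 'I_n) (U : {set 'I_n}) k x :
  #|U| = k -> x \in U -> exists i : 'I_k, setnth x0 U i = x.
Proof.
move=> cU xU; have lt : (index x (enum U) < k)%N.
  by rewrite -cU cardE index_mem mem_enum.
by exists (Ordinal lt); rewrite /setnth nth_index // mem_enum.
Qed.

(** Words with a repetition give two equal rows and vanish. The injective words with image [U] are
    the enumeration of [U] composed with a permutation, and the signs of these permutations assemble
    the minor of [A]. *)
Lemma Cauchy_Binet k n (x0 : 'I_n) (A : 'M[R]_(k, n)) (B : 'M[R]_(n, k)) :
  \det (A *m B) = \sum_(U : {set 'I_n} | #|U| == k)
     \det (\matrix_(i, j) A i (setnth x0 U j)) *
     \det (\matrix_(i, j) B (setnth x0 U i) j).
Proof.
rewrite det_mul_words (bigID (fun f : {ffun 'I_k -> 'I_n} => injectiveb f)) /=.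
rewrite [X in _ + X]big1 ?addr0; last first.
  move=> f /injectivePn[i [j ij fij]].
  by rewrite (determinant_alternate ij) ?mulr0 // => l; rewrite !mxE fij.
rewrite (partition_big (fun f : {ffun 'I_k -> 'I_n} => [set f i | i : 'I_k])
  (fun U => #|U| == k)) /=; last first.
  by move=> f /injectiveP inj_f; rewrite card_imset // card_ord.
apply: eq_bigr => U /eqP cU.
pose h (s : 'S_k) := [ffun i => setnth x0 U (s i)].
pose h' (f : {ffun 'I_k -> 'I_n}) : 'S_k := odflt 1%g [pick s | h s == f].
have h_inj : injective h.
  move=> s t /ffunP e; apply/permP => i.
  by have := e i; rewrite !ffunE => /(setnth_inj cU).
rewrite (reindex_onto h h') /=; last first.
  move=> f /andP[/injectiveP f_inj /eqP imf].
  rewrite /h'; case: pickP => [s /eqP // |no].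
  have ex i : {j : 'I_k | setnth x0 U j == f i}.
    by apply/sigW; case: (@setnth_onto _ x0 U k (f i) cU) => [|j e];
      [rewrite -imf imset_f | exists j; rewrite e].
  have inj_p : injective (fun i => sval (ex i)).
    by move=> i j e; apply: f_inj; rewrite -(eqP (svalP (ex i))) -(eqP (svalP (ex j))) e.
  have := no (perm inj_p); case/eqP; apply/ffunP => i.
  by rewrite ffunE permE; apply/eqP/(svalP (ex i)).
rewrite [\det (\matrix_(i, j) A i (setnth x0 U j))]/determinant mulr_suml; apply: eq_big => [s|s _].
  apply/andP; split; last first.
    by rewrite /h'; case: pickP => [t /eqP/h_inj ->//|/(_ s)]; rewrite eqxx.
  apply/andP; split.
    by apply/injectiveP => i j; rewrite !ffunE => /(setnth_inj cU) /perm_inj.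
  apply/eqP/setP => x; apply/imsetP/idP => [[i _ ->]|xU].
    by rewrite ffunE mem_setnth.
  have [i <-] := @setnth_onto _ x0 U k x cU xU.
  by exists ((s^-1)%g i) => //; rewrite ffunE permKV.
have -> : \matrix_(i, j) B (h s i) j =
    row_perm s (\matrix_(i, j) B (setnth x0 U i) j).
  by apply/matrixP => i j; rewrite !mxE ffunE.
rewrite row_permE det_mulmx det_perm mulrCA mulrA; congr (_ * _ * _).
by apply: eq_bigr => i _; rewrite mxE ffunE.
Qed.

End CauchyBinet.

Section Minors.
Variables (R : comNzRingType) (n' : nat).
Notation n := n'.+1.
Implicit Types (g h : 'M[R]_n) (S T U : {set 'I_n}).

Definition submatrix k g S T : 'M[R]_k :=
  \matrix_(i, j) g (setnth ord0 S i) (setnth ord0 T j).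

(** Unlike [minor], this makes sense over any commutative ring, in particular for the generic matrix
    with polynomial entries. *)
Definition gminor g S T : R :=
  if #|S| == #|T| then \det (submatrix #|S| g S T) else 0.

Lemma gminorE k g S T : #|S| = k -> #|T| = k ->
  gminor g S T = \det (submatrix k g S T).
Proof. by move=> cS cT; rewrite /gminor cS cT eqxx. Qed.

Lemma gminor_card g S T : #|S| != #|T| -> gminor g S T = 0.
Proof. by rewrite /gminor => /negPf ->. Qed.

Lemma gminorM g h S T :
  gminor (g *m h) S T = \sum_U gminor g S U * gminor h U T.
Proof.
have [ST|/eqP ST] := eqVneq #|S| #|T|; last first.
  rewrite gminor_card; last exact/eqP.
  rewrite big1 // => U _; have [SU|SU] := eqVneq #|S| #|U|.
    by rewrite [X in _ * X]gminor_card ?mulr0 // -SU; apply/eqP.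
  by rewrite gminor_card ?mul0r.
rewrite (bigID (fun U => #|U| == #|T|)) /= [X in _ + X]big1 ?addr0; last first.
  by move=> U UT; rewrite [X in _ * X]gminor_card ?mulr0.
rewrite (@gminorE #|T|) //.
have -> : submatrix #|T| (g *m h) S T =
   (\matrix_(i, a) g (setnth ord0 S i) a) *m (\matrix_(a, j) h a (setnth ord0 T j)).
  by apply/matrixP => i j; rewrite !mxE; apply: eq_bigr => a _; rewrite !mxE.
rewrite (Cauchy_Binet ord0); apply: eq_bigr => U /eqP cU.
rewrite !(@gminorE #|T|) //; congr (_ * _); congr (determinant _);
by apply/matrixP => i j; rewrite !mxE.
Qed.

Lemma gminor_row0 g S T x : x \in S -> (forall y, y \in T -> g x y = 0) ->
  gminor g S T = 0.
Proof.
move=> xS g0; have [ST|] := eqVneq #|S| #|T|; last exact: gminor_card.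
rewrite (@gminorE #|T|) //.
have [i xE] := @setnth_onto _ ord0 S _ x ST xS.
rewrite (expand_det_row _ i) big1 // => j _.
by rewrite mxE xE g0 ?mul0r // mem_setnth.
Qed.

Lemma gminor_col0 g S T y : y \in T -> (forall x, x \in S -> g x y = 0) ->
  gminor g S T = 0.
Proof.
move=> yT g0; have [ST|] := eqVneq #|S| #|T|; last exact: gminor_card.
rewrite (@gminorE #|T|) //.
have [i yE] := @setnth_onto _ ord0 T _ y erefl yT.
rewrite (expand_det_col _ i) big1 // => j _.
by rewrite mxE yE g0 ?mul0r // mem_setnth.
Qed.

Lemma sorted_enum_set S : sorted (fun x y : 'I_n => (x < y)%N) (enum S).
Proof.
change (sorted (relpre (val : 'I_n -> nat) ltn) (enum S)); rewrite -sorted_map.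
apply: (@subseq_sorted _ _ ltn_trans _ (map val (enum 'I_n))).
  by apply: map_subseq; rewrite [X in subseq _ X]enumT; apply: filter_subseq.
by rewrite val_enum_ord iota_ltn_sorted.
Qed.

Lemma enum_set_sorted S (s : seq 'I_n) :
  sorted (fun x y : 'I_n => (x < y)%N) s -> s =i S -> enum S = s.
Proof.
move=> ss sS; apply: (@irr_sorted_eq _ (fun x y : 'I_n => (x < y)%N)) => //.
- by move=> x y z; apply: ltn_trans.
- by move=> x; rewrite /= ltnn.
- exact: sorted_enum_set.
- by move=> x; rewrite mem_enum sS.
Qed.

Lemma setnth_mono S k : #|S| = k ->
  {mono (@setnth n ord0 S k) : i j / (i < j)%N}.
Proof.
move=> cS.
have lt_mono (i j : 'I_k) : (i < j)%N -> (setnth ord0 S i < setnth ord0 S j)%N.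
  move=> ij; apply: (sorted_ltn_nth _ ord0 (sorted_enum_set S)) => //.
  - by move=> x y z; apply: ltn_trans.
  - by rewrite inE -cardE cS.
  - by rewrite inE -cardE cS.
move=> i j; apply/idP/idP; last exact: lt_mono.
apply: contraTT; rewrite -!leqNgt leq_eqVlt => /orP[/eqP/val_inj->//|].
by move/lt_mono/ltnW.
Qed.

Lemma gminor_tri g S : (forall x y : 'I_n, (y < x)%N -> g x y = 0) ->
  gminor g S S = \prod_(x in S) g x x.
Proof.
move=> tri; rewrite (@gminorE #|S|) // -det_tr det_trig; last first.
  apply/is_trig_mxP => i j ij; rewrite !mxE tri // setnth_mono //.
rewrite -[RHS]big_enum (big_nth ord0) -cardE big_mkord.
by apply: eq_bigr => i _; rewrite !mxE.
Qed.

End Minors.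

(** * The action on tensor products of exterior powers *)

Section TensorAction.
Variables (R : comNzRingType) (n' : nat).
Notation n := n'.+1.
Implicit Types (g h : 'M[R]_n) (S T U : {set 'I_n}).

Lemma gminor_diag (d : 'I_n -> R) g S T :
  (forall x y, g x y = d x *+ (x == y)) ->
  gminor g S T = (\prod_(x in S) d x) *+ (S == T).
Proof.
move=> gE; have [<-|ST] := eqVneq S T.
  rewrite gminor_tri; last by move=> x y xy; rewrite gE -val_eqE gtn_eqF.
  by apply: eq_bigr => x _; rewrite gE eqxx.
have [cST|] := eqVneq #|S| #|T|; last exact: gminor_card.
have /subsetPn[x xS xT] : ~~ (S \subset T).
  by apply: contra ST => sST; rewrite eqEcard sST cST leqnn.
apply: (gminor_row0 xS) => y yT; rewrite gE.
by have [xy|] := eqVneq x y; rewrite ?mulr0n //; move: xT; rewrite xy yT.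
Qed.

(** A set [S] of the same size as the initial segment [T] but different from it has an element
    outside [T], hence above all of [T]; the corresponding row of the submatrix is zero. *)
Lemma gminor_unitri g S T :
  (forall x y : 'I_n, (y < x)%N -> g x y = 0) -> (forall x, g x x = 1) ->
  (forall x y : 'I_n, x \in T -> (y <= x)%N -> y \in T) ->
  gminor g S T = (S == T)%:R.
Proof.
move=> tri diag ini; have [<-|ST] := eqVneq S T.
  by rewrite gminor_tri // big1.
have [cST|] := eqVneq #|S| #|T|; last exact: gminor_card.
have /subsetPn[x xS xT] : ~~ (S \subset T).
  by apply: contra ST => sST; rewrite eqEcard sST cST leqnn.
apply: (gminor_row0 xS) => y yT; apply: tri; rewrite ltnNge.
by apply: contra xT; apply: ini.
Qed.

Lemma gminor_set1 g x y : gminor g [set x] [set y] = g x y.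
Proof.
rewrite (@gminorE _ _ 1) ?cards1 // det_mx11 mxE.
by rewrite /setnth !enum_set1.
Qed.

Variable m : nat.
Notation tix := {ffun 'I_m -> {set 'I_n}}.
Implicit Types (w : tix -> R) (A B C : tix).

Definition gact g w A : R := \sum_(B : tix) (\prod_j gminor g (A j) (B j)) * w B.

Lemma eq_gact g w w' : w =1 w' -> gact g w =1 gact g w'.
Proof. by move=> e A; apply: eq_bigr => B _; rewrite e. Qed.

Lemma gactM g h w A : gact (g *m h) w A = gact g (gact h w) A.
Proof.
rewrite /gact; under eq_bigr => B _.
  under eq_bigr do rewrite gminorM.
  rewrite bigA_distr_bigA mulr_suml /=.
  over.
rewrite exchange_big; apply: eq_bigr => C _ /=; rewrite mulr_sumr.
by apply: eq_bigr => B _; rewrite big_split mulrA.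
Qed.

Lemma gact_diag (d : 'I_n -> R) g w A :
  (forall x y, g x y = d x *+ (x == y)) ->
  gact g w A = (\prod_j \prod_(x in A j) d x) * w A.
Proof.
move=> gE; rewrite /gact (bigD1 A) //= [X in _ + X]big1 ?addr0.
  congr (_ * _); apply: eq_bigr => j _.
  by rewrite (gminor_diag _ _ gE) eqxx.
move=> B /eqP BA; have [j ABj] : exists j, A j != B j.
  apply/existsP; rewrite -negb_forall; apply/negP => /forallP e.
  by apply: BA; apply/ffunP => j; rewrite (eqP (e j)).
by rewrite (bigD1 j) //= (gminor_diag _ _ gE) (negPf ABj) mulr0n !mul0r.
Qed.

Lemma gact1 w A : gact 1%:M w A = w A.
Proof.
rewrite (@gact_diag (fun=> 1)); first by rewrite big1 ?mul1r // => j _; rewrite big1.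
by move=> x y; rewrite mxE.
Qed.

Definition pure A B : R := (B == A)%:R.

Lemma gact_pure g A B : gact g (pure A) B = \prod_j gminor g (B j) (A j).
Proof.
rewrite /gact (bigD1 A) //= [X in _ + X]big1 /pure ?eqxx ?mulr1 ?addr0 //.
by move=> C /negPf ->; rewrite mulr0.
Qed.

(** The elementary matrix 1 + E_{i,i+1} with indices counted from 0; it is the identity when [i.+1]
    is not an index. *)
Definition raise (i : nat) : 'M[R]_n :=
  \matrix_(x, y) ((x == y) || ((x == i :> nat) && (y == i.+1 :> nat)))%:R.

Lemma raise_diag i x : raise i x x = 1.
Proof. by rewrite mxE eqxx. Qed.

Lemma raise_tri i (x y : 'I_n) : (y < x)%N -> raise i x y = 0.
Proof.
move=> yx; rewrite mxE -val_eqE gtn_eqF //=.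
by case: eqP => //= xi; case: eqP => //= yi; rewrite xi yi ltnNge leqnSn in yx.
Qed.

Definition initial (A : tix) :=
  forall j (x y : 'I_n), x \in A j -> (y <= x)%N -> y \in A j.

Lemma gact_raise_pure i A B : initial A -> gact (raise i) (pure A) B = pure A B.
Proof.
move=> iA; rewrite gact_pure /pure.
under eq_bigr => j _ do rewrite (gminor_unitri _ (@raise_tri i) (raise_diag i) (@iA j)).
case: eqP => [->|BA]; first by rewrite big1 // => j _; rewrite eqxx.
have [j ABj] : exists j, B j != A j.
  apply/existsP; rewrite -negb_forall; apply/negP => /forallP e.
  by apply: BA; apply/ffunP => j; rewrite (eqP (e j)).
by rewrite (bigD1 j) //= (negPf ABj) mul0r.
Qed.

(** The weight of the basis tensor indexed by [A], see [prod_mult]. *)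
Definition mult A (i : 'I_n) : nat := #|[set j | i \in A j]|.

Lemma prod_mult (d : 'I_n -> R) A :
  \prod_j \prod_(x in A j) d x = \prod_x d x ^+ mult A x.
Proof.
under eq_bigr do rewrite big_mkcond.
rewrite exchange_big; apply: eq_bigr => x _.
by rewrite /mult -prodr_const [RHS]big_mkcond; apply: eq_bigr => j _; rewrite inE.
Qed.

End TensorAction.

Section RingMorphism.
Variables (R R' : comNzRingType) (f : {rmorphism R -> R'}) (n' m : nat).
Notation n := n'.+1.

Lemma gminor_map (g : 'M[R]_n) S T : f (gminor g S T) = gminor (map_mx f g) S T.
Proof.
rewrite /gminor; case: eqP => _; last exact: rmorph0.
rewrite -det_map_mx; congr (\det _).
by apply/matrixP => i j; rewrite !mxE.
Qed.

Lemma gact_map g w (A : {ffun 'I_m -> {set 'I_n}}) :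
  f (gact g w A) = gact (map_mx f g) (f \o w) A.
Proof.
rewrite /gact rmorph_sum; apply: eq_bigr => B _.
rewrite rmorphM rmorph_prod; congr (_ * _).
by apply: eq_bigr => j _; rewrite gminor_map.
Qed.

Lemma raise_map i : map_mx f (raise R n' i) = raise R' n' i.
Proof. by apply/matrixP => x y; rewrite !mxE rmorph_nat. Qed.

End RingMorphism.

(** * The action over a field and the highest weight vector *)

Section Field.
Variables (K : fieldType) (n' : nat).
Notation n := n'.+1.
Implicit Types (g : 'M[K]_n).

Lemma minorE g S T : minor K n g S T = gminor g S T.
Proof.
rewrite /minor /gminor; case: eqP => // ST; congr (\det _).
apply/matrixP => i j; rewrite !mxE (nth_map ord0) -?cardE //.
by rewrite (nth_map ord0) // -cardE -ST.
Qed.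

Lemma actE nu g w S : act K n nu g w S = gact g w S.
Proof.
rewrite ffunE; apply: eq_bigr => T _; congr (_ * _).
by apply: eq_bigr => j _; rewrite minorE.
Qed.

Lemma act_mul nu g h w : act K n nu (g *m h) w = act K n nu g (act K n nu h w).
Proof.
apply/ffunP => S; rewrite !actE gactM; apply: eq_gact => T.
by rewrite actE.
Qed.

Lemma act_is_linear nu g : linear (act K n nu g).
Proof.
move=> a u v; apply/ffunP => S; rewrite !ffunE.
rewrite scaler_sumr -big_split; apply: eq_bigr => T _ /=.
by rewrite !ffunE mulrDr; congr (_ + _); rewrite mulrCA.
Qed.

HB.instance Definition _ nu g :=
  GRing.isLinear.Build K (amb K n nu) (amb K n nu) _ (act K n nu g) (@act_is_linear nu g).

(** The columns of the tableau of shape [nu] whose row [i] is filled with [i]. *)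
Definition hwidx (nu : seq nat) : tidx n nu :=
  [ffun j : 'I_(ncols nu) => [set i : 'I_n | (j < nth 0 nu i)%N]].

Definition hwvec nu : amb K n nu := [ffun S => pure K (hwidx nu) S].

Lemma act_hwvec nu g S :
  act K n nu g (hwvec nu) S = \prod_j gminor g (S j) (hwidx nu j).
Proof.
rewrite actE -gact_pure; apply: eq_gact => T; by rewrite ffunE.
Qed.

Lemma nth_sorted_geq (nu : seq nat) i j : sorted geq nu -> (i <= j)%N ->
  (nth 0 nu j <= nth 0 nu i)%N.
Proof.
move=> snu ij; have [jn|jn] := ltnP j (size nu); last by rewrite [nth 0 nu j]nth_default.
apply: (sorted_leq_nth _ _ 0%N snu) => //; last by rewrite inE (leq_ltn_trans ij).
- by move=> x y z yx zy; apply: leq_trans zy yx.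
- exact: leqnn.
Qed.

Lemma hwidx_initial nu : sorted geq nu -> initial (hwidx nu).
Proof.
move=> snu j x y; rewrite !ffunE !inE => jx yx.
exact: leq_trans jx (nth_sorted_geq _ _).
Qed.

Lemma mult_hwidx nu i : sorted geq nu -> mult (hwidx nu) i = nth 0%N nu i.
Proof.
move=> snu; rewrite /mult -sum1_card.
rewrite (eq_bigl (fun j : 'I_(ncols nu) => (j < nth 0%N nu i)%N)); last first.
  by move=> j; rewrite !inE ffunE inE.
rewrite (big_ord_narrow (nth_sorted_geq snu (leq0n i))) /= sum1_card.
by rewrite card_ord.
Qed.

End Field.

(** * Polynomial functions over an infinite field *)

Section InfiniteField.
Variable K : fieldType.
Hypothesis Kinf : forall s : seq K, exists x : K, x \notin s.

Lemma poly_nonroot (q : {poly K}) : q != 0 -> exists x, q.[x] != 0.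
Proof.
move=> q0; have long k : exists2 s : seq K, uniq s & size s = k.
  elim: k => [|k [s us <-]]; first by exists [::].
  by have [x xs] := Kinf s; exists (x :: s); rewrite /= ?xs.
have [s us ss] := long (size q).
have : ~~ all (root q) s.
  by apply/negP => rs; have := max_poly_roots q0 rs us; rewrite ss ltnn.
by case/allPn => x _ qx; exists x.
Qed.

Lemma digits_inj N D (f g : nat -> nat) :
  (forall i, i < N -> f i < D)%N -> (forall i, i < N -> g i < D)%N ->
  (\sum_(i < N) f i * D ^ i = \sum_(i < N) g i * D ^ i)%N ->
  forall i, (i < N)%N -> f i = g i.
Proof.
elim: N f g => [|N IH] f g fD gD //.
have D0 : (0 < D)%N by apply: leq_ltn_trans (fD 0%N isT).
have shift (h : nat -> nat) : (\sum_(i < N.+1) h i * D ^ i =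
    h 0 + D * \sum_(i < N) h i.+1 * D ^ i)%N.
  rewrite big_ord_recl /= expn0 muln1 big_distrr /=; congr (_ + _)%N.
  by apply: eq_bigr => i _; rewrite /bump add1n expnS mulnCA.
rewrite !shift => e.
have e0 : f 0%N = g 0%N.
  have := congr1 (modn^~ D) e.
  by rewrite /= !(mulnC D) !(addnC (_ 0%N)) !modnMDl !modn_small ?fD ?gD.
case=> [//|i]; rewrite ltnS; apply: (IH (fun i => f i.+1) (fun i => g i.+1)).
- by move=> j jN; apply: fD.
- by move=> j jN; apply: gD.
by move/eqP: e; rewrite e0 eqn_add2l eqn_pmul2l // => /eqP.
Qed.

(* Kronecker's substitution X_i |-> x ^ (D ^ i) keeps distinct monomials distinct. *)
Lemma mpoly_nonroot N (p : {mpoly K[N]}) : p != 0 -> exists e, p.@[e] != 0.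
Proof.
move=> p0; pose D := msize p.
pose key (m : 'X_{1..N}) := (\sum_(i < N) m i * D ^ i)%N.
have keyE (m : 'X_{1..N}) : key m = (\sum_(i < N) nth 0 m i * D ^ i)%N.
  by apply: eq_bigr => i _; rewrite (mnm_nth 0%N).
have ltD m i : m \in msupp p -> (i < N)%N -> (nth 0 m i < D)%N.
  move=> mp iN; apply: leq_ltn_trans (msize_mdeg_lt mp).
  by rewrite -(mnm_nth 0%N m (Ordinal iN)) mdegE (bigD1 (Ordinal iN)) //= leq_addr.
have key_inj : {in msupp p &, injective key}.
  move=> m m' mp m'p; rewrite !keyE => e; apply/mnmP => i.
  rewrite !(mnm_nth 0%N); apply: (digits_inj _ _ e) => // j jN; exact: ltD.
pose q : {poly K} := \sum_(m <- msupp p) p@_m *: 'X^(key m).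
have q0 : q != 0.
  apply/eqP => /(congr1 (fun q : {poly K} => q`_(key (mlead p)))).
  rewrite coef_sum coef0 (bigD1_seq (mlead p)) ?msupp_uniq ?mlead_supp //=.
  rewrite big_seq_cond big1 ?addr0.
    by rewrite coefZ coefXn eqxx mulr1 => /eqP; rewrite mleadc_eq0 (negPf p0).
  move=> m /andP[mp ne]; rewrite coefZ coefXn; case: eqP; rewrite ?mulr0 // => e.
  by move: ne; rewrite (key_inj _ _ (mlead_supp p0) mp e) eqxx.
have [x qx] := poly_nonroot q0; exists (fun i => x ^+ (D ^ i)).
rewrite mevalE; move: qx; rewrite /q horner_sum.
congr (_ != _); apply: eq_bigr => m _; rewrite hornerZ hornerXn; congr (_ * _).
rewrite /key -prodrXr; apply: eq_bigr => i _; by rewrite mulnC exprM.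
Qed.

(** The product [q * p] vanishes at every point, hence is zero, and polynomials form a domain. *)
Lemma mpoly_vanish N (q p : {mpoly K[N]}) : q != 0 ->
  (forall e, q.@[e] != 0 -> p.@[e] = 0) -> p = 0.
Proof.
move=> q0 vp; apply/eqP; apply: contraT => p0.
have [e] : exists e, (q * p).@[e] != 0 by apply: mpoly_nonroot; rewrite mulf_neq0.
by rewrite mevalM; have [->|/vp->] := eqVneq q.@[e] 0; rewrite (mul0r, mulr0) eqxx.
Qed.

(** The coordinates of the sum minus its projection to [W] are polynomials in [e] that vanish
    wherever [q] does not, so all their coefficients are zero. The polynomial [q] allows testing on
    a dense set such as the invertible matrices. *)
Lemma mem_coefficients N (vT : vectType K) (W : {vspace vT}) (q : {mpoly K[N]})
    (r : seq 'X_{1..N}) (u : 'X_{1..N} -> vT) : q != 0 -> uniq r ->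
  (forall e, q.@[e] != 0 ->
     \sum_(m <- r) (\prod_i e i ^+ m i) *: u m \in W) ->
  forall m, m \in r -> u m \in W.
Proof.
move=> q0 ur inW m mr.
suff: u m - projv W (u m) == 0 by rewrite subr_eq0 => /eqP->; apply: memv_proj.
set b := vbasis (fullv : {vspace vT}).
have cE v : v = \sum_(i < \dim fullv) coord b i v *: b`_i.
  by apply: coord_vbasis; apply: memvf.
rewrite [X in X == _]cE big1 // => i _.
pose p := \sum_(m <- r) coord b i (u m - projv W (u m)) *: 'X_[K, m].
suff p0 : p = 0.
  have := congr1 (mcoeff m) p0; rewrite mcoeff0 raddf_sum (bigD1_seq m) //= big1.
    by rewrite addr0 mcoeffZ mcoeffX eqxx mulr1 => ->; rewrite scale0r.
  by move=> m' /negPf ne; rewrite mcoeffZ mcoeffX ne mulr0.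
apply: (mpoly_vanish q0) => e /inW; set v := \sum_(m <- r) _ => vW.
have -> : p.@[e] = coord b i (v - projv W v).
  have -> : v - projv W v =
      \sum_(m <- r) (\prod_i e i ^+ m i) *: (u m - projv W (u m)).
    rewrite /v linear_sum -sumrB; apply: eq_bigr => m' _.
    by rewrite linearZ /= scalerBr.
  rewrite !linear_sum /=; apply: eq_bigr => m' _.
  by rewrite mevalZ mevalX linearZ mulrC.
by rewrite projv_id ?subrr ?linear0.
Qed.

End InfiniteField.

(** * Matrix entries as polynomial variables *)

Section MatrixVariables.
Variable n' : nat.
Notation n := n'.+1.

Lemma vix_subproof (i v : 'I_n) : (i * n + v < n * n)%N.
Proof.
apply: (@leq_trans (i * n + n)); first by rewrite ltn_add2l.
by rewrite -mulSnr leq_mul2r orbC ltn_ord.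
Qed.

(* The variable standing for the entry in row v and column i of a matrix; the
   columns are listed first so that the monomial order compares columns
   lexicographically. *)
Definition vix (i v : 'I_n) : 'I_(n * n) := Ordinal (vix_subproof i v).

Lemma vix_div (i v : 'I_n) : (vix i v %/ n)%N = i.
Proof. by rewrite /= divnMDl // divn_small ?addn0. Qed.

Lemma vix_mod (i v : 'I_n) : (vix i v %% n)%N = v.
Proof. by rewrite /= modnMDl modn_small. Qed.

Lemma vix_inj i v i' v' : vix i v = vix i' v' -> i = i' /\ v = v'.
Proof.
move=> e; split; apply: val_inj; first by rewrite -[LHS](vix_div i v) e vix_div.
by rewrite -[LHS](vix_mod i v) e vix_mod.
Qed.

Lemma eq_vix i v i' v' : (vix i v == vix i' v') = (i == i') && (v == v').
Proof.
apply/eqP/andP => [/vix_inj[-> ->]//|[/eqP-> /eqP->] //].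
Qed.

Definition vcol (k : 'I_(n * n)) : 'I_n := inord (k %/ n).
Definition vrow (k : 'I_(n * n)) : 'I_n := inord (k %% n).

Lemma vixK k : vix (vcol k) (vrow k) = k.
Proof.
apply: val_inj; rewrite /= !inordK ?ltn_mod //; first by rewrite -divn_eq.
by rewrite ltn_divLR.
Qed.

Lemma vcolE i v : vcol (vix i v) = i.
Proof. by have [] := vix_inj (vixK (vix i v)). Qed.

Lemma vrowE i v : vrow (vix i v) = v.
Proof. by have [] := vix_inj (vixK (vix i v)). Qed.

Lemma big_vix (T : Type) (idx : T) (op : Monoid.com_law idx) (F : 'I_(n * n) -> T) :
  \big[op/idx]_k F k = \big[op/idx]_i \big[op/idx]_v F (vix i v).
Proof.
rewrite pair_big /= (reindex (fun q : 'I_n * 'I_n => vix q.1 q.2)) //=.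
exists (fun k => (vcol k, vrow k)) => [[i v]|k] _ /=; first by rewrite vcolE vrowE.
exact: vixK.
Qed.

Definition mx_of (R : Type) (e : 'I_(n * n) -> R) : 'M[R]_n :=
  \matrix_(v, i) e (vix i v).

Lemma mx_ofK (R : Type) (g : 'M[R]_n) : mx_of (fun k => g (vrow k) (vcol k)) = g.
Proof. by apply/matrixP => v i; rewrite mxE vrowE vcolE. Qed.

End MatrixVariables.

(** * Weyl modules as spans of orbits *)

(* Compare the signs of the two Vandermonde products over [(s j - s i)] and
   over [(j - i)]. *)
Lemma odd_perm_inversions k (s : 'S_k) :
  odd_perm s = odd (\sum_(i < k) \sum_(j < k | (i < j)%N) (s j < s i))%N.
Proof.
pose V a : 'M[int]_k := Vandermonde k (\row_j a j).
have detV a : \det (V a) =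
    \prod_(i < k) \prod_(j < k | (i < j)%N) (a j - a i).
  rewrite det_Vandermonde; apply: eq_bigr => i _; apply: eq_bigr => j _.
  by rewrite !mxE.
have sg_prod I r (P : pred I) (F : I -> int) :
    Num.sg (\prod_(i <- r | P i) F i) = \prod_(i <- r | P i) Num.sg (F i).
  exact: (big_morph _ (@sgrM _) (@sgr1 _)).
have /(congr1 Num.sg) : \det (V (fun j => (s j)%:Z)) =
    (-1) ^+ s * \det (V (fun j => (j : nat)%:Z)).
  have -> : V (fun j => (s j)%:Z) = col_perm s (V (fun j => (j : nat)%:Z)).
    by apply/matrixP => i j; rewrite !mxE.
  by rewrite col_permE det_mulmx det_perm odd_permV mulrC.
have sg_sign (b : bool) : Num.sg ((-1) ^+ b : int) = (-1) ^+ b by case: b.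
rewrite sgrM sg_sign !detV !sg_prod.
rewrite [X in _ * X]big1 ?mulr1; last first.
  by move=> i _; rewrite sg_prod big1 // => j ij; rewrite gtr0_sg // subr_gt0 ltz_nat.
under eq_bigr => i _.
  rewrite sg_prod; under eq_bigr => j ij.
    rewrite (_ : Num.sg _ = (-1) ^+ (s j < s i)%N); last first.
      case: (ltngtP (s j) (s i)) => [lt|lt|/val_inj/perm_inj e].
      - by rewrite ltr0_sg // subr_lt0 ltz_nat.
      - by rewrite gtr0_sg // subr_gt0 ltz_nat.
      - by rewrite e ltnn in ij.
    over.
  rewrite prodrXr; over.
rewrite prodrXr => e; symmetry.
by apply: (@signr_inj int); rewrite signr_odd.
Qed.

(** * Minors as coefficients of wedge products *)

Section Wedge.
Variables (K : fieldType) (n' : nat).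
Notation n := n'.+1.
Implicit Types (g : 'M[K]_n) (S T : {set 'I_n}).

Definition wedge_at S (w : seq 'I_n) : K :=
  if [set x in w] == S then wedge_coef K n w else 0.

Lemma inversions_word k (w : 'I_k -> 'I_n) :
  inversions n [seq w i | i <- enum 'I_k] =
  (\sum_(i < k) \sum_(j < k | (i < j)%N) (w j < w i))%N.
Proof.
have nthw (i : 'I_k) :
    nth 0%N (map val [seq w a | a <- enum 'I_k]) i = w i.
  by rewrite -map_comp (nth_map i) ?size_enum_ord // nth_ord_enum.
rewrite /inversions; set l := [seq w i | i <- enum 'I_k] in nthw *.
have -> : size l = k by rewrite size_map size_enum_ord.
by apply: eq_bigr => i _; apply: eq_bigr => j _; rewrite !nthw.
Qed.

(** If the word enumerates [S], the matrix is a permutation matrix whose sign counts the inversions;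
    otherwise it has two equal rows or a zero row. *)
Lemma det_word k S (w : {ffun 'I_k -> 'I_n}) : #|S| = k ->
  \det (\matrix_(i, j) (w i == setnth ord0 S j)%:R) =
  wedge_at S [seq w i | i <- enum 'I_k].
Proof.
move=> cS; rewrite /wedge_at /wedge_coef.
have [/injectiveP w_inj|] := boolP (injectiveb w); last first.
  move=> w_ninj; have -> : uniq [seq w i | i <- enum 'I_k] = false.
    exact: negbTE.
  rewrite if_same; have /injectivePn[i [j ij wij]] := w_ninj.
  by rewrite (determinant_alternate ij) // => l; rewrite !mxE wij.
have uw : uniq [seq w i | i <- enum 'I_k] by rewrite map_inj_uniq // enum_uniq.
rewrite uw; case: eqP => [wS|wS]; last first.
  have /subsetPn[x] : ~~ ([set x in [seq w i | i <- enum 'I_k]] \subset S).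
    apply/negP => sub; apply: wS; apply/eqP; rewrite eqEcard sub cS /=.
    by rewrite cardsE (card_uniqP uw) size_map size_enum_ord.
  rewrite inE => /mapP[i _ ->] wiS; rewrite (expand_det_row _ i) big1 // => j _.
  rewrite mxE; case: eqP => [e|_]; last by rewrite mul0r.
  by rewrite e mem_setnth in wiS.
have ex i : {j : 'I_k | setnth ord0 S j == w i}.
  apply/sigW; case: (@setnth_onto _ ord0 S k (w i) cS) => [|j e].
    by rewrite -wS inE map_f // mem_enum.
  by exists j; rewrite e.
have [f wE] : exists f : 'I_k -> 'I_k, forall i, w i = setnth ord0 S (f i).
  by exists (fun i => sval (ex i)) => i; rewrite (eqP (svalP (ex i))).
have s_inj : injective f by move=> i j e; apply: w_inj; rewrite !wE e.
have -> : \matrix_(i, j) (w i == setnth ord0 S j)%:R = perm_mx (perm s_inj) :> 'M[K]_k.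
  apply/matrixP => i j; rewrite !mxE permE wE.
  by rewrite (inj_eq (setnth_inj cS)).
rewrite det_perm inversions_word -[RHS]signr_odd odd_perm_inversions.
congr (_ ^+ nat_of_bool (odd _)); apply: eq_bigr => i _; apply: eq_bigr => j _.
by rewrite !wE setnth_mono // !permE.
Qed.

Lemma wedge_at_card S w : #|S| != size w -> wedge_at S w = 0.
Proof.
move=> ne; rewrite /wedge_at /wedge_coef; case: eqP => // wS.
case: ifP => // uw; case/negP: ne.
by rewrite -wS cardsE (card_uniqP uw).
Qed.

(** Words indexed by [T] are encoded as functions on all of ['I_n] with the value [ord0] off [T], so
    that their type does not depend on [T]. *)
Definition off0 T (u : {ffun 'I_n -> 'I_n}) :=
  [forall i, (i \notin T) ==> (u i == ord0)].

(** The wedge of the columns of [g] in [T] is expanded over all choices [u] of one row in each of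
    these columns. *)
Lemma gminor_expand g S T : gminor g S T =
  \sum_(u | off0 T u) (\prod_(i in T) g (u i) i) * wedge_at S [seq u i | i <- enum T].
Proof.
have [cST|cST] := eqVneq #|S| #|T|; last first.
  rewrite gminor_card // big1 // => u _.
  by rewrite wedge_at_card ?mulr0 // size_map -cardE.
rewrite (@gminorE _ _ #|T|) // -det_tr.
have -> : (submatrix #|T| g S T)^T =
    (\matrix_(i, a) g a (setnth ord0 T i)) *m (\matrix_(a, j) (a == setnth ord0 S j)%:R).
  apply/matrixP => i j; rewrite !mxE (bigD1 (setnth ord0 S j)) //= big1.
    by rewrite !mxE eqxx mulr1 addr0.
  by move=> a /negPf ne; rewrite !mxE ne mulr0.
rewrite det_mul_words.
pose h (w : {ffun 'I_#|T| -> 'I_n}) : {ffun 'I_n -> 'I_n} :=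
  [ffun i => if [pick a | setnth ord0 T a == i] is Some a then w a else ord0].
pose h' (u : {ffun 'I_n -> 'I_n}) : {ffun 'I_#|T| -> 'I_n} :=
  [ffun a => u (setnth ord0 T a)].
have hE w (a : 'I_#|T|) : h w (setnth ord0 T a) = w a.
  rewrite ffunE; case: pickP => [b /eqP/(setnth_inj erefl)->//|/(_ a)].
  by rewrite eqxx.
rewrite [RHS](reindex_onto h h') /=; last first.
  move=> u /forallP off; apply/ffunP => i; rewrite ffunE.
  case: pickP => [a /eqP <-|none]; first by rewrite ffunE.
  have := off i; case: (boolP (i \in T)) => //= iT; last by move/eqP.
  by have [a ai] := @setnth_onto _ ord0 T _ i erefl iT; have := none a; rewrite ai eqxx.
apply: eq_big => [w|w _].
  symmetry; apply/andP; split.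
    apply/forallP => i; apply/implyP => iT; rewrite ffunE; case: pickP => // a /eqP ai.
    by rewrite -ai mem_setnth in iT.
  by apply/eqP/ffunP => a; rewrite ffunE hE.
congr (_ * _).
  rewrite -[RHS]big_enum (big_nth ord0) -cardE big_mkord.
  by apply: eq_bigr => a _; rewrite mxE hE.
transitivity (\det (\matrix_(i, j) (w i == setnth ord0 S j)%:R) : K).
  by congr (\det _); apply/matrixP => i j; rewrite !mxE.
rewrite det_word //; congr wedge_at.
have sz : size [seq w i | i <- enum 'I_#|T|] = #|T| by rewrite size_map size_enum_ord.
apply: (@eq_from_nth _ ord0); first by rewrite sz size_map -cardE.
rewrite sz => i ik; pose a := Ordinal ik.
rewrite (nth_map a) ?size_enum_ord // (nth_map ord0) -?cardE //.
by rewrite -[i]/(val a) nth_ord_enum -(hE w a).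
Qed.

End Wedge.

(** * The orbit map of the highest weight vector *)

Section WeylOrbit.
Variables (K : fieldType) (n' : nat).
Notation n := n'.+1.
Variable nu : seq nat.
Notation m := (ncols nu).
Notation cells := (cells n nu).
Notation filling := (filling n nu).
Notation hwidx := (hwidx n' nu).
Notation hwvec := (hwvec K n' nu).
Notation Weyl := (Weyl K n nu).
Notation act := (act K n nu).
Implicit Types (F : filling) (g : 'M[K]_n).

(** A column of [F] as a total function, with the value [ord0] off the shape, to match [off0]. *)
Definition fillcol F (j : 'I_m) : {ffun 'I_n -> 'I_n} :=
  [ffun i => oapp F ord0 (insub (i, j))].

Lemma fillcolE F (c : cells) : fillcol F (val c).2 (val c).1 = F c.
Proof. by rewrite ffunE -surjective_pairing valK. Qed.

Lemma filter_allpairs (I J : eqType) (P : pred (I * J)) (r : seq I) (s : seq J) j :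
  uniq s -> j \in s ->
  [seq c <- [seq (x, y) | x <- r, y <- s] | (c.2 == j) && P c] =
  [seq (x, j) | x <- r & P (x, j)].
Proof.
move=> us js; elim: r => //= x r IH; rewrite filter_cat IH.
have -> : [seq c <- [seq (x, y) | y <- s] | (c.2 == j) && P c] =
    if P (x, j) then [:: (x, j)] else [::].
  rewrite filter_map /= (eq_filter (a2 := fun y => (y == j) && P (x, j))).
    case: (P (x, j)); last first.
      by rewrite (eq_filter (a2 := pred0)) ?filter_pred0 // => y; rewrite andbF.
    rewrite (eq_filter (a2 := pred1 j)); last by move=> y; rewrite andbT.
    by rewrite filter_pred1_uniq.
  by move=> y /=; case: eqP => [->|].
by case: (P (x, j)).
Qed.

(** Cells are enumerated in the order of pairs, row index first, so the word of a column is read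
    from top to bottom. *)
Lemma colwE F j : colw n nu F j = [seq fillcol F j i | i <- enum (hwidx j)].
Proof.
pose G (c : 'I_n * 'I_m) := oapp F ord0 (insub c).
have valE : map val (enum [set: cells]) = filter (cellP n nu) (enum {: 'I_n * 'I_m}).
  rewrite enum_setT unlock (pmap_filter (insubK _)) -enumT.
  by apply: eq_filter => c; rewrite /= isSome_insub.
have -> : colw n nu F j = map G [seq c <- map val (enum [set: cells]) | c.2 == j].
  rewrite filter_map -map_comp; apply: eq_map => c /=.
  by rewrite /G valK.
rewrite valE -filter_predI [enum {: 'I_n * 'I_m}]enumT unlock /=.
rewrite /prod_enum.
rewrite filter_allpairs ?enum_uniq ?mem_enum //.
rewrite -map_comp (_ : enum (hwidx j) = [seq x <- enum 'I_n | cellP n nu (x, j)]).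
  by apply: eq_map => i; rewrite ffunE.
transitivity (filter (mem (hwidx j)) (enum 'I_n)); first by rewrite [X in _ = filter _ X]enumT.
by apply: eq_filter => i; rewrite /= ffunE inE.
Qed.

Lemma fvecE F S : fvec K n nu F S = \prod_j wedge_at K (S j) (colw n nu F j).
Proof. by rewrite ffunE. Qed.

(** Each minor is expanded by [gminor_expand] and the product over the columns is distributed; a
    choice of one word for every column is the same as a filling. *)
Lemma act_hwvec_expand g : act g hwvec =
  \sum_(F : filling) (\prod_(c : cells) g (F c) (val c).1) *: fvec K n nu F.
Proof.
apply/ffunP => S; rewrite act_hwvec sum_ffunE.
under eq_bigr do rewrite gminor_expand.
rewrite bigA_distr_big_dep /=.
pose h F : {ffun 'I_m -> {ffun 'I_n -> 'I_n}} := [ffun j => fillcol F j].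
pose h' (f : {ffun 'I_m -> {ffun 'I_n -> 'I_n}}) : filling :=
  [ffun c => f (val c).2 (val c).1].
rewrite (reindex_onto h h') /=; last first.
  move=> f /familyP fam; apply/ffunP => j; apply/ffunP => i; rewrite !ffunE.
  case: insubP => [c _ cE|nc] /=; first by rewrite ffunE cE.
  have /forallP/(_ i)/implyP := fam j; rewrite ffunE inE => /(_ nc)/eqP.
  by move->.
apply: eq_big => [F|F _].
  apply/andP; split; last by apply/eqP/ffunP => c; rewrite !ffunE -fillcolE ffunE.
  apply/familyP => j; apply/forallP => i; apply/implyP.
  by rewrite !ffunE inE => nc; rewrite insubF //; apply: negbTE.
rewrite ffunE fvecE big_split /=; congr (_ * _); last first.
  by apply: eq_bigr => j _; rewrite colwE ffunE.
rewrite (eq_bigr (fun c : cells => g (fillcol F (val c).2 (val c).1) (val c).1)); last first.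
  by move=> c _; rewrite fillcolE.
have -> : \prod_(c : cells) g (fillcol F (val c).2 (val c).1) (val c).1 =
    \prod_(q | cellP n nu q) g (fillcol F q.2 q.1) q.1.
  rewrite [RHS](reindex_omap (val : cells -> 'I_n * 'I_m) insub) => [|q qP]; last by rewrite insubT.
  by apply: eq_bigl => c; rewrite valK eqxx (valP c).
rewrite pair_big_dep (reindex (fun q : 'I_n * 'I_m => (q.2, q.1))) /=; last first.
  by exists (fun q => (q.2, q.1)) => [[]|[]].
apply: eq_big => [[i j]|[i j] _] /=; first by rewrite ffunE inE.
by rewrite ffunE.
Qed.

(** The exponent of the variable in row [v] and column [i] counts the entries [v] in row [i] of [F].
    Thus the monomial records exactly the row contents, and its fibres are the row equivalence
    classes. *)
Definition fmono F : 'X_{1..n * n} :=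
  [multinom count_mem (vrow k) (roww n nu F (vcol k)) | k < n * n].

Lemma rowequivE F F' : rowequiv n nu F F' = (fmono F == fmono F').
Proof.
apply/forallP/eqP => [eqv|/mnmP e i].
  apply/mnmP => k; rewrite !mnmE.
  by have /seq.permP -> := eqv (vcol k).
apply/allP => v _ /=; have := e (vix i v).
by rewrite !mnmE vcolE vrowE => ->.
Qed.

Lemma prod_fmono (e : 'I_(n * n) -> K) F :
  \prod_(c : cells) mx_of e (F c) (val c).1 = \prod_k e k ^+ fmono F k.
Proof.
rewrite big_vix (partition_big (fun c : cells => (val c).1) xpredT) //=.
apply: eq_bigr => i _; rewrite (partition_big F xpredT) //=.
apply: eq_bigr => v _; rewrite mnmE vcolE vrowE.
rewrite (eq_bigr (fun=> e (vix i v))); last first.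
  by move=> c /andP[/eqP <- /eqP <-]; rewrite mxE.
rewrite big_const iter_mulr_1; congr (_ ^+ _).
rewrite count_map count_filter enum_setT cardE /enum_mem size_filter -enumT.
by apply: eq_count => c /=; rewrite andbC.
Qed.

Definition fmonos := undup [seq fmono F | F <- enum filling].

(** The vectors [dprime_basis] appear here as the coefficients of the polynomial map sending a
    matrix [g] to [act g hwvec]. *)
Lemma act_hwvec_monomials (e : 'I_(n * n) -> K) : act (mx_of e) hwvec =
  \sum_(x <- fmonos) (\prod_k e k ^+ x k) *: \sum_(F | fmono F == x) fvec K n nu F.
Proof.
rewrite act_hwvec_expand.
under [RHS]eq_bigr do rewrite scaler_sumr big_mkcond.
rewrite exchange_big; apply: eq_bigr => F _; rewrite -big_mkcond /=.
rewrite (eq_bigl (pred1 (fmono F))) => [|x]; last by rewrite /= eq_sym.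
rewrite -big_filter filter_pred1_uniq ?undup_uniq ?mem_undup ?map_f ?mem_enum //.
by rewrite big_seq1 prod_fmono.
Qed.

Lemma dprime_fmono F :
  dprime_basis K n nu F = \sum_(F' | fmono F' == fmono F) fvec K n nu F'.
Proof. by apply: eq_bigl => F'; rewrite rowequivE eq_sym. Qed.

Lemma mem_Weyl_act g : act g hwvec \in Weyl.
Proof.
rewrite -[g]mx_ofK act_hwvec_monomials big_seq.
apply: memv_suml => x; rewrite mem_undup => /mapP[F _ ->].
by rewrite -dprime_fmono memvZ // memv_span // map_f // mem_enum.
Qed.

Lemma mem_Weyl_hwvec : hwvec \in Weyl.
Proof.
have -> : hwvec = act 1%:M hwvec by apply/ffunP => S; rewrite actE gact1.
exact: mem_Weyl_act.
Qed.

Hypothesis Kinf : forall s : seq K, exists x : K, x \notin s.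

(** The generators of the Weyl module are coefficients of the orbit map, so by [mem_coefficients]
    they lie in any subspace containing the orbit of a dense set of matrices. *)
Lemma Weyl_sub (q : {mpoly K[n * n]}) (W : {vspace amb K n nu}) : q != 0 ->
  (forall e, q.@[e] != 0 -> act (mx_of e) hwvec \in W) -> (Weyl <= W)%VS.
Proof.
move=> q0 inW; apply/span_subvP => _ /mapP[F _ ->].
rewrite dprime_fmono.
apply: (@mem_coefficients _ Kinf _ _ W q fmonos
  (fun x => \sum_(F | fmono F == x) fvec K n nu F)) => //.
- exact: undup_uniq.
- by move=> e /inW; rewrite act_hwvec_monomials.
- by rewrite mem_undup map_f // mem_enum.
Qed.

Lemma Weyl_ind (W : {vspace amb K n nu}) :
  (forall g, act g hwvec \in W) -> forall w, w \in Weyl -> w \in W.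
Proof. by move=> inW; apply/subvP/(@Weyl_sub 1); rewrite ?oner_neq0. Qed.

Lemma Weyl_ext (vT : vectType K) (f f' : {linear amb K n nu -> vT}) :
  (forall g, f (act g hwvec) = f' (act g hwvec)) ->
  forall w, w \in Weyl -> f w = f' w.
Proof.
move=> eff w wW; apply/eqP; rewrite -subr_eq0.
suff: w \in lker (linfun f - linfun f')%VF.
  by rewrite memv_ker !lfunE /= opp_lfunE !lfunE.
move: w wW; apply: Weyl_ind => g.
by rewrite memv_ker !lfunE /= opp_lfunE !lfunE /= eff subrr.
Qed.

Lemma mem_Weyl_linear (vT : vectType K) (W : {vspace vT}) (f : {linear amb K n nu -> vT}) :
  (forall g, f (act g hwvec) \in W) -> forall w, w \in Weyl -> f w \in W.
Proof.
move=> fW w wW; rewrite -[f w](lfunE f) memv_preim.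
by move: w wW; apply: Weyl_ind => g; rewrite -memv_preim lfunE /= fW.
Qed.

Lemma Weyl_stable g w : w \in Weyl -> act g w \in Weyl.
Proof.
by apply: (mem_Weyl_linear (f := act g)) => h; rewrite /= -act_mul mem_Weyl_act.
Qed.

End WeylOrbit.

(** * Leading monomials of invariant polynomials *)

Section Substitution.
Variables (K : fieldType) (N : nat).
Notation R := {mpoly K[N]}.

Lemma msupp_prod_rel (Phi : 'X_{1..N} -> 'X_{1..N} -> Prop) (s : 'I_N -> R) :
  Phi 0%MM 0%MM ->
  (forall a b c d, Phi a b -> Phi c d -> Phi (a + c)%MM (b + d)%MM) ->
  (forall k y, y \in msupp (s k) -> Phi U_(k)%MM y) ->
  forall x y : 'X_{1..N}, y \in msupp (\prod_k s k ^+ x k) -> Phi x y.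
Proof.
move=> Phi0 PhiD PhiU x.
pose Q (a : 'X_{1..N}) (p : R) := forall y, y \in msupp p -> Phi a y.
have Q0 : Q 0%MM 1 by move=> y; rewrite msupp1 inE => /eqP->.
have QD a p b q : Q a p -> Q b q -> Q (a + b)%MM (p * q).
  by move=> Qp Qq y /msuppM_le/allpairsP[[c d] /= [cp dq ->]]; apply: PhiD; auto.
suff : Q (\sum_k (U_(k) *+ x k))%MM (\prod_k s k ^+ x k).
  by rewrite -multinomUE_id.
apply: (@big_ind2 _ _ Q) => // k _.
elim: (x k) => [|e IH]; first by rewrite mulm0n expr0.
by rewrite mulmS exprS; apply: QD => // y; apply: PhiU.
Qed.

End Substitution.

(** * Semistandardness of leading monomials *)

Section Garnir.
Variables (K : fieldType) (n' : nat).
Notation n := n'.+1.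
Notation N := (n * n)%N.
Notation R := {mpoly K[N]}.
Implicit Types (P : R) (G : 'M[R]_n) (x y : 'X_{1..N}).

Definition colsum x (i : 'I_n) : nat := (\sum_v x (vix i v))%N.

Definition subst P G : R := P \mPo [tuple G (vrow k) (vcol k) | k < N].

Lemma substE P G :
  subst P G = \sum_(x <- msupp P) P@_x *: \prod_k G (vrow k) (vcol k) ^+ x k.
Proof.
rewrite /subst comp_mpolyE; apply: eq_bigr => x _; congr (_ *: _).
by apply: eq_bigr => k _; rewrite tnth_mktuple.
Qed.

(** The matrix [G] has polynomial entries, so invariance may be applied to matrices of
    indeterminates such as [rhs] below. *)
Definition Uinvariant (la : seq nat) P :=
  (forall x, x \in msupp P -> forall i, colsum x i = nth 0%N la i) /\
  (forall i G, subst P (G *m raise R n' i) = subst P G).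

Lemma mul_raise G (i i1 : 'I_n) v j : i1 = i.+1 :> nat ->
  (G *m raise R n' i) v j = G v j + (if j == i1 then G v i else 0).
Proof.
move=> i1E; rewrite mxE (bigD1 j) //= raise_diag mulr1; congr (_ + _).
case: eqP => [->|ji1].
  have ii1 : i != i1 by rewrite -val_eqE /= i1E ltn_eqF.
  rewrite (bigD1 i) //= [raise _ _ _ _ _]mxE (negPf ii1) i1E !eqxx mulr1.
  rewrite big1 ?addr0 // => u /andP[ui1 ui].
  by rewrite mxE (negPf ui1) (negPf ui : (u == i :> nat) = false) mulr0.
rewrite big1 // => u uj; rewrite mxE (negPf uj) /=.
have -> : (j == i.+1 :> nat) = false.
  by rewrite -i1E; apply/negP => /eqP/val_inj.
by rewrite andbF mulr0.
Qed.

Lemma leq_sum_eq (I : finType) (a b : I -> nat) :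
  (forall u, b u <= a u)%N -> (\sum_u a u = \sum_u b u)%N -> a =1 b.
Proof.
move=> ba e u; apply/eqP; rewrite eqn_leq ba andbT leqNgt; apply/negP => lt.
have: (\sum_u b u < \sum_u a u)%N; last by rewrite e ltnn.
rewrite [X in (X < _)%N](bigD1 u) // [X in (_ < X)%N](bigD1 u) //=.
by rewrite -addSn leq_add // leq_sum.
Qed.

Lemma leq_sum_but1 (I : finType) (a b : I -> nat) u0 :
  (forall u, u != u0 -> b u <= a u)%N -> (\sum_u a u = \sum_u b u)%N ->
  (a u0 <= b u0)%N.
Proof.
move=> ba; rewrite (bigD1 u0) // [RHS](bigD1 u0) //= => e.
have: (\sum_(u | u != u0) b u <= \sum_(u | u != u0) a u)%N by apply: leq_sum.
by lia.
Qed.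

Section Straighten.
Variables (i i1 x0 : 'I_n).
Hypothesis i1E : i1 = i.+1 :> nat.
Notation X j v := ('X_(vix j v) : R).

Let ii1 : (i == i1) = false.
Proof. by apply/negbTE; rewrite -val_eqE /= i1E ltn_eqF. Qed.
Let i1i : (i1 == i) = false.
Proof. by rewrite eq_sym ii1. Qed.

(* The matrix [lhs] is [rhs] with column i added to column i+1.  Column i is
   s + y and column i+1 is b + y, resp. b - s, for generic vectors s, y and b,
   where s is supported in the rows < x0 and b in the rows > x0. *)
Definition coli (v : 'I_n) : R :=
  if (v < x0)%N then X i v + X i1 v else if v == x0 then X i v else X i1 v.
Definition lhs : 'M[R]_n := \matrix_(v < n, j < n)
  if j == i then coli v else
  if j == i1 then
    (if (v < x0)%N then X i1 v else if v == x0 then X i v else X i v + X i1 v)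
  else X j v.
Definition rhs : 'M[R]_n := \matrix_(v < n, j < n)
  if j == i then coli v else
  if j == i1 then
    (if (v < x0)%N then - X i v else if v == x0 then 0 else X i v)
  else X j v.

Lemma lhs_rhs : lhs = rhs *m raise R n' i.
Proof.
apply/matrixP => v j; rewrite (mul_raise _ _ _ i1E) !mxE eqxx /coli.
case: (eqVneq j i) => [->|ji]; first by rewrite ii1 addr0.
case: (eqVneq j i1) => _; last by rewrite addr0.
by case: ltnP => _; [rewrite addKr | case: eqP => _; rewrite ?add0r].
Qed.

(** Conditions for [y] to occur in the image of [x] under [lhs]: the variables of column [i] come
    only from column [i] in rows above [x0] and only from column [i1] in rows below it, and each row
    keeps its total degree in the two columns. *)
Definition PhiL x y := [/\
  forall v : 'I_n, (v < x0)%N -> (y (vix i v) <= x (vix i v))%N,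
  forall v : 'I_n, (x0 < v)%N -> (y (vix i v) <= x (vix i1 v))%N,
  forall v, (y (vix i v) + y (vix i1 v) = x (vix i v) + x (vix i1 v))%N &
  forall j v, j != i -> j != i1 -> y (vix j v) = x (vix j v)].

(** Every nonzero entry in column [i1] of [rhs] is, up to sign, a variable of column [i] in a row
    other than [x0]. *)
Definition PhiR x y :=
  (colsum x i1 <= \sum_(v | v != x0) y (vix i v))%N.

Lemma PhiL_U (a b u : 'I_n) :
  ((u < x0)%N -> (a == i) <= (b == i))%N -> ((x0 < u)%N -> (a == i) <= (b == i1))%N ->
  ((a == i) + (a == i1) = (b == i) + (b == i1))%N ->
  (forall j, j != i -> j != i1 -> (a == j) = (b == j)) ->
  PhiL U_(vix b u)%MM U_(vix a u)%MM.
Proof.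
move=> h1 h2 h3 h4; split => [v vx|v vx|v|j v ji ji1]; rewrite !mnm1E !eq_vix.
- by case: (eqVneq u v) => [e|_]; rewrite ?andbF // !andbT h1 ?e.
- by case: (eqVneq u v) => [e|_]; rewrite ?andbF // !andbT h2 ?e.
- by case: (eqVneq u v) => [e|_]; rewrite ?andbF // !andbT h3 ?e.
- by rewrite h4.
Qed.

Lemma PhiL_lhs x y :
  y \in msupp (\prod_k lhs (vrow k) (vcol k) ^+ x k) -> PhiL x y.
Proof.
move: x y; apply: msupp_prod_rel.
- by split => *; rewrite !mnm0E.
- move=> a b c d [h1 h2 h3 h4] [k1 k2 k3 k4]; split => *; rewrite !mnmDE.
  + by rewrite leq_add ?h1 ?k1.
  + by rewrite leq_add ?h2 ?k2.
  + by rewrite addnACA h3 k3 addnACA.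
  + by rewrite h4 ?k4.
move=> k y; have [j [u ->]] : exists j u, k = vix j u.
  by exists (vcol k), (vrow k); rewrite vixK.
rewrite mxE vcolE vrowE.
have supp2 a b : y \in msupp ('X_a + 'X_b : R) -> y = U_(a)%MM \/ y = U_(b)%MM.
  by move/msuppD_le; rewrite mem_cat !msuppX !inE => /orP[]/eqP; [left|right].
have supp1 a : y \in msupp ('X_a : R) -> y = U_(a)%MM.
  by rewrite msuppX inE => /eqP.
have other l : l != i -> l != i1 -> (i == l) = (i1 == l).
  by move=> li li1; rewrite ![_ == l]eq_sym (negPf li) (negPf li1).
have U2 (a b : 'I_n) : (a == i) || (a == i1) -> (b == i) || (b == i1) ->
    ((u < x0)%N -> (a == i) <= (b == i))%N -> ((x0 < u)%N -> (a == i) <= (b == i1))%N ->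
    PhiL U_(vix b u)%MM U_(vix a u)%MM.
  move=> ha hb h1 h2; apply: PhiL_U => //.
    by case/orP: ha => /eqP->; case/orP: hb => /eqP->; rewrite !eqxx ?ii1 ?i1i.
  move=> l li li1.
  by case/orP: ha => /eqP->; case/orP: hb => /eqP->; rewrite ?(other l).
case: (eqVneq j i) => [->|ji].
  rewrite /coli; case: (ltngtP u x0) => [ux|ux|/val_inj ux].
  - by move/supp2 => [] ->; apply: U2; rewrite ?eqxx ?ii1 ?i1i ?orbT //; lia.
  - rewrite -val_eqE gtn_eqF // => /supp1 ->.
    by apply: U2; rewrite ?eqxx ?ii1 ?i1i ?orbT //; lia.
  - rewrite ux eqxx => /supp1; rewrite -ux => ->.
    by apply: U2; rewrite ?eqxx ?ii1 ?i1i ?orbT // -ux ltnn.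
case: (eqVneq j i1) => [->|ji1].
  case: (ltngtP u x0) => [ux|ux|/val_inj ux].
  - by move/supp1 => ->; apply: U2; rewrite ?eqxx ?ii1 ?i1i ?orbT //; lia.
  - rewrite -val_eqE gtn_eqF // => /supp2 [] ->;
    by apply: U2; rewrite ?eqxx ?ii1 ?i1i ?orbT //; lia.
  - rewrite ux eqxx => /supp1; rewrite -ux => ->.
    by apply: U2; rewrite ?eqxx ?ii1 ?i1i ?orbT // -ux ltnn.
by move/supp1 => ->; apply: PhiL_U; rewrite ?(negPf ji) ?(negPf ji1).
Qed.

Lemma PhiR_rhs x y :
  y \in msupp (\prod_k rhs (vrow k) (vcol k) ^+ x k) -> PhiR x y.
Proof.
move: x y; apply: msupp_prod_rel.
- by rewrite /PhiR /colsum big1 // => v _; rewrite mnm0E.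
- move=> a b c d hab hcd; rewrite /PhiR /colsum.
  under eq_bigr do rewrite mnmDE; under [Y in (_ <= Y)%N]eq_bigr do rewrite mnmDE.
  by rewrite !big_split leq_add.
move=> k y; have [j [u ->]] : exists j u, k = vix j u.
  by exists (vcol k), (vrow k); rewrite vixK.
rewrite mxE vcolE vrowE.
have [jE|ji1] := eqVneq j i1; last first.
  by rewrite /PhiR /colsum big1 // => v _; rewrite mnm1E eq_vix (negPf ji1).
rewrite jE i1i => ys.
have [ux yE] : u != x0 /\ y = U_(vix i u)%MM.
  move: ys; case: ltnP => [ux|_].
    by rewrite (perm_mem (msuppN _)) msuppX inE => /eqP ->; rewrite -val_eqE ltn_eqF.
  case: eqP => [_|/eqP ux]; first by rewrite msupp0.
  by rewrite msuppX inE => /eqP ->.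
rewrite /PhiR /colsum (bigD1 u) //= yE mnm1E eqxx [Y in (1 + Y)%N]big1.
  by rewrite addn0 (bigD1 u) //= mnm1E eqxx.
by move=> v vu; rewrite mnm1E eq_vix [u == v]eq_sym (negPf vu) andbF.
Qed.

(** The leading variable of the entry of [lhs] in row [v] and column [j] is the one in row [v] and
    column [pivot j v]; hence [tau x] is the leading monomial of the image of [x]. *)
Definition pivot (j v : 'I_n) : 'I_n :=
  if (v < x0)%N then j else if v == x0 then (if j == i1 then i else j) else
  if j == i then i1 else if j == i1 then i else j.

Definition tau x : 'X_{1..N} :=
  (\sum_k U_(vix (pivot (vcol k) (vrow k)) (vrow k)) *+ x k)%MM.

Lemma tauE x j v : tau x (vix j v) = (\sum_l (pivot l v == j) * x (vix l v))%N.
Proof.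
rewrite /tau mnm_sumE big_vix; apply: eq_bigr => l _.
rewrite (bigD1 v) //= big1 ?addn0.
  by rewrite mulmnE mnm1E vcolE vrowE eq_vix eqxx andbT.
by move=> u uv; rewrite mulmnE mnm1E vcolE vrowE eq_vix (negPf uv) andbF.
Qed.

Lemma tau_small x (v : 'I_n) : (v < x0)%N -> tau x (vix i v) = x (vix i v).
Proof.
move=> vx; rewrite tauE (bigD1 i) //= /pivot vx eqxx mul1n big1 ?addn0 //.
by move=> l /negPf ->.
Qed.

Lemma tau_large x (v : 'I_n) : (x0 < v)%N -> tau x (vix i v) = x (vix i1 v).
Proof.
move=> vx; have vE : (v == x0) = false by rewrite -val_eqE gtn_eqF.
rewrite tauE (bigD1 i1) //= /pivot ltnNge (ltnW vx) /= vE i1i !eqxx mul1n big1 ?addn0 // => l li1.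
by rewrite (negPf li1); case: (eqVneq l i) => [_|/negPf->]; rewrite ?i1i.
Qed.

Lemma mlead_XDX (a b : 'I_N) : (a < b)%N ->
  mlead ('X_a + 'X_b : R) = U_(a)%MM /\ mleadc ('X_a + 'X_b : R) = 1.
Proof.
move=> ab; have ba : (b == a) = false by rewrite -val_eqE gtn_eqF.
have e : mlead ('X_a + 'X_b : R) = U_(a)%MM.
  rewrite mleadDl !mleadXm //; apply/ltmcP; first by rewrite !mdeg1.
  exists a; last by rewrite !mnm1E eqxx ba.
  by move=> j ja; rewrite !mnm1E -!val_eqE !gtn_eqF // (ltn_trans ja).
by split=> //; rewrite e mcoeffD !mcoeffX eqxx eq_mnm1 ba addr0.
Qed.

Lemma mlead_lhs k (p := lhs (vrow k) (vcol k)) :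
  mlead p = U_(vix (pivot (vcol k) (vrow k)) (vrow k))%MM /\ mleadc p = 1.
Proof.
have lead1 a : mlead ('X_a : R) = U_(a)%MM /\ mleadc ('X_a : R) = 1.
  by rewrite mleadXm mcoeffX eqxx.
have lt v : (vix i v < vix i1 v)%N by rewrite /= ltn_add2r ltn_mul2r i1E ltnSn.
rewrite /p mxE /coli /pivot; move: (vcol k) (vrow k) => j v.
case: (eqVneq j i) => [->|ji].
  rewrite ii1; case: ltnP => _; first exact: mlead_XDX.
  by case: eqP => _; apply: lead1.
case: (eqVneq j i1) => [->|ji1]; last by rewrite !if_same.
case: ltnP => _ //; case: eqP => [_|_] //; exact: mlead_XDX.
Qed.

Lemma coef_lhs x : (\prod_k lhs (vrow k) (vcol k) ^+ x k)@_(tau x) = 1.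
Proof.
have lX k : mlead (lhs (vrow k) (vcol k) ^+ x k) =
    (U_(vix (pivot (vcol k) (vrow k)) (vrow k)) *+ x k)%MM.
  have [le lc] := mlead_lhs k; rewrite mleadX ?le //.
  by apply/eqP => p0; move/eqP: lc; rewrite p0 mcoeff0 eq_sym oner_eq0.
rewrite /tau -(eq_bigr _ (fun k _ => lX k)) mleadc_prod big1 // => k _.
have [le lc] := mlead_lhs k.
by rewrite lX -le mleadcX lc expr1n.
Qed.

Lemma colsum_mdeg x y : (forall j, colsum x j = colsum y j) -> mdeg x = mdeg y.
Proof. by move=> e; rewrite !mdegE !big_vix; apply: eq_bigr => j _; apply: e. Qed.

(** At the first position where the exponents differ, [y] has the larger one. The inequalities in
    [PhiL], the equal row totals over the two columns and the equal column sums exclude every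
    possible position. *)
Lemma PhiL_tau_max x y : (forall j, colsum x j = colsum y j) ->
  (x <= y)%O -> PhiL x (tau y) -> PhiL y (tau y) -> x = y.
Proof.
move=> cxy; rewrite le_eqVlt => /orP[/eqP//|].
move/(ltmcP (colsum_mdeg cxy)) => [k0 below lt0] [h1 h2 h3 h4] [_ _ k3 k4].
exfalso; move: below lt0; rewrite -(vixK k0).
move: (vcol k0) (vrow k0) => j v below lt0.
have sums u : (x (vix i u) + x (vix i1 u) = y (vix i u) + y (vix i1 u))%N.
  by rewrite -h3 k3.
have large (u : 'I_n) : (x0 < u)%N -> (y (vix i1 u) <= x (vix i1 u))%N.
  by move=> ux; rewrite -tau_large // h2.
have small (u : 'I_n) : (u < x0)%N -> (y (vix i u) <= x (vix i u))%N.
  by move=> ux; rewrite -{1}(tau_small y ux) h1.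
have lt_col (j' u u' : 'I_n) : (u < u')%N -> (vix j' u < vix j' u')%N.
  by rewrite /= ltn_add2l.
have vlt (u u' : 'I_n) : (vix i u < vix i1 u')%N.
  by rewrite /= i1E mulSn; have := ltn_ord u; lia.
have small1 (u : 'I_n) : (forall u' : 'I_n, (u' < x0)%N -> x (vix i u') = y (vix i u')) ->
    (u < x0)%N -> x (vix i1 u) = y (vix i1 u).
  by move=> e ux; have := sums u; rewrite e // => /addnI.
(* Above [x0] the two columns agree; below [x0] column [i1] of [y] is bounded by that of [x].
   Equality of the column sums reverses the inequality at row [x0], and the row total transfers it
   to column [i]. *)
have all_small : (forall u' : 'I_n, (u' < x0)%N -> x (vix i u') = y (vix i u')) ->
    (y (vix i x0) <= x (vix i x0))%N.
  move=> e; suff : (x (vix i1 x0) <= y (vix i1 x0))%N by have := sums x0; lia.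
  apply: (@leq_sum_but1 _ (fun u => x (vix i1 u)) (fun u => y (vix i1 u))); last exact: cxy.
  move=> u ux0; case: (ltngtP u x0) => [ux|ux|/val_inj e'].
  - by rewrite small1.
  - exact: large.
  - by rewrite e' eqxx in ux0.
(* Agreement in column [i] up to row [x0] leaves only inequalities in one direction in column [i1],
   which equality of the column sums turns into equalities. *)
have all_upto : (forall u' : 'I_n, (u' <= x0)%N -> x (vix i u') = y (vix i u')) ->
    forall u, x (vix i1 u) = y (vix i1 u) /\ x (vix i u) = y (vix i u).
  move=> e.
  have e1 : (fun u => x (vix i1 u)) =1 (fun u => y (vix i1 u)).
    apply: leq_sum_eq; last exact: cxy.
    move=> u; case: (leqP u x0) => [ux|]; last exact: large.
    by have := sums u; rewrite e // => /addnI ->.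
  by move=> u; split; [exact: e1 | have := sums u; have := e1 u; lia].
case: (eqVneq j i) => [jE|ji].
  subst j; case: (ltngtP v x0) => [vx|vx|/val_inj vx].
  - by have := small _ vx; lia.
  - have [|_ e] := all_upto _ v; last by move: lt0; rewrite e ltnn.
    by move=> u ux; apply: below; apply: lt_col; lia.
  - have : (y (vix i x0) <= x (vix i x0))%N.
      by apply: all_small => u ux; apply: below; rewrite vx lt_col.
    by rewrite -vx; lia.
case: (eqVneq j i1) => [jE|ji1].
  subst j; have [|e _] := all_upto _ v; last by move: lt0; rewrite e ltnn.
  by move=> u _; apply: below; apply: vlt.
by move: lt0; rewrite -(h4 _ _ ji ji1) k4 // ltnn.
Qed.

(* Compare the coefficients of [tau (mlead P)] in P(lhs) = P(rhs): on the left
   only the leading monomial of P contributes, on the right nothing does if the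
   inequality fails. *)
Lemma lead_semistandard la P : Uinvariant la P -> P != 0 ->
  (\sum_(v : 'I_n | v <= x0) mlead P (vix i1 v) <= \sum_(v : 'I_n | v < x0) mlead P (vix i v))%N.
Proof.
move=> [hdeg hinv] P0; set M := mlead P.
rewrite leqNgt; apply/negP => viol.
have MP : M \in msupp P by apply: mlead_supp.
have cM x : x \in msupp P -> forall j, colsum x j = colsum M j.
  by move=> xP j; rewrite !hdeg.
have tauM : tau M \in msupp (\prod_k lhs (vrow k) (vcol k) ^+ M k).
  by rewrite mcoeff_msupp coef_lhs oner_neq0.
have := congr1 (mcoeff (tau M)) (hinv i rhs).
rewrite -lhs_rhs !substE !raddf_sum /= (bigD1_seq M) ?msupp_uniq //=.
rewrite [Y in _ + Y = _]big_seq_cond [Y in _ + Y = _]big1 ?addr0; last first.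
  move=> x /andP[xP xM]; rewrite mcoeffZ [Y in _ * Y]memN_msupp_eq0 ?mulr0 //.
  apply/negP => /PhiL_lhs Px; move/eqP: xM; apply.
  apply: (PhiL_tau_max (cM _ xP)) => //; first exact: msupp_le_mlead.
  exact: PhiL_lhs.
rewrite [RHS]big_seq [RHS]big1 => [|x xP].
  by rewrite mcoeffZ coef_lhs mulr1 => /eqP; rewrite mleadc_eq0 (negPf P0).
rewrite mcoeffZ [Y in _ * Y]memN_msupp_eq0 ?mulr0 //; apply/negP => /PhiR_rhs.
rewrite /PhiR cM // /colsum leqNgt => /negP; apply.
(* The rows below [x0] contribute the same amount to both sides, by [tau_large]; what remains is the
   assumed violation. *)
rewrite [Y in (_ < Y)%N](bigID (fun v : 'I_n => (v <= x0)%N)) /=.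
rewrite (bigID (fun v : 'I_n => (v < x0)%N)) /=.
rewrite (eq_bigl (fun v : 'I_n => (v < x0)%N)); last first.
  by move=> v; rewrite -val_eqE; case: ltngtP.
rewrite (eq_bigr (fun v => M (vix i v))); last by move=> v; apply: tau_small.
rewrite [Y in (_ + Y < _)%N](eq_bigl (fun v : 'I_n => ~~ (v <= x0)%N)); last first.
  by move=> v; rewrite -val_eqE; case: ltngtP.
rewrite [Y in (_ + Y < _)%N](eq_bigr (fun v => M (vix i1 v))).
  by rewrite ltn_add2r.
by move=> v; rewrite -ltnNge; apply: tau_large.
Qed.

End Straighten.
End Garnir.

(** * Bideterminants *)

Section Bideterminants.
Variables (K : fieldType) (n' : nat).
Notation n := n'.+1.
Notation N := (n * n)%N.
Notation R := {mpoly K[N]}.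
Implicit Types (P : R) (x y : 'X_{1..N}) (S T : {set 'I_n}).

Definition Xmx : 'M[R]_n := mx_of (fun k => 'X_k).

Lemma mleadP P y : P@_y != 0 -> (forall x, x \in msupp P -> (x <= y)%O) -> mlead P = y.
Proof.
move=> Py le; apply/le_anti; rewrite msupp_le_mlead ?mcoeff_msupp // andbT.
by apply: le; apply: mlead_supp; apply: contraNneq Py => ->; rewrite mcoeff0.
Qed.

Definition pmono k S T (s : 'S_k) : 'X_{1..N} :=
  (\sum_b U_(vix (setnth ord0 T b) (setnth ord0 S (s b))))%MM.

Lemma pmonoE k S T (s : 'S_k) (b : 'I_k) v : #|T| = k ->
  pmono S T s (vix (setnth ord0 T b) v) = (setnth ord0 S (s b) == v).
Proof.
move=> cT; rewrite mnm_sumE (bigD1 b) //= mnm1E eq_vix eqxx big1 ?addn0 //.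
by move=> c cb; rewrite mnm1E eq_vix (inj_eq (setnth_inj cT)) (negPf cb).
Qed.

Lemma pmono_notin k S T (s : 'S_k) i v : #|T| = k -> i \notin T ->
  pmono S T s (vix i v) = 0%N.
Proof.
move=> cT iT; rewrite mnm_sumE big1 // => b _; rewrite mnm1E eq_vix.
by case: eqP => // e; rewrite -e mem_setnth in iT.
Qed.

Lemma colsum_pmono k S T (s : 'S_k) i : #|T| = k ->
  colsum (pmono S T s) i = (i \in T).
Proof.
move=> cT; rewrite /colsum; case: (boolP (i \in T)) => iT; last first.
  by rewrite big1 // => v _; apply: pmono_notin.
have [b <-] := @setnth_onto _ ord0 T k i cT iT.
under eq_bigr do rewrite pmonoE //.
by rewrite (bigD1 (setnth ord0 S (s b))) //= eqxx big1 // => v /negPf; rewrite eq_sym => ->.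
Qed.

Lemma gminor_Xmx k S T : #|S| = k -> #|T| = k ->
  gminor Xmx S T = \sum_(s : 'S_k) (-1) ^+ s *: 'X_[pmono S T s].
Proof.
move=> cS cT; rewrite (@gminorE _ _ k) // -det_tr; apply: eq_bigr => s _.
rewrite -mul_mpolyC rmorph_sign; congr (_ * _).
rewrite -mprodXE; apply: eq_bigr => b _.
by rewrite !mxE.
Qed.

(** The first index [b] moved by [s] is moved upwards. There the diagonal monomial contains a
    variable that precedes the one chosen by [s], and all earlier exponents agree. *)
Lemma pmono_lt k S T (s : 'S_k) : #|S| = k -> #|T| = k -> s != 1%g ->
  (pmono S T s < pmono S T (1%g : 'S_k))%O.
Proof.
move=> cS cT s1; apply/ltmcP.
  by apply: colsum_mdeg => i; rewrite !colsum_pmono.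
have [b0 sb0] : exists b, s b != b.
  apply/existsP; rewrite -negb_forall; apply: contra s1 => /forallP e.
  by apply/eqP/permP => b; rewrite perm1; apply/eqP.
case: (arg_minnP (P := fun b => s b != b) (fun b : 'I_k => (b : nat)) sb0) => b sb min_b.
have fix_below (c : 'I_k) : (c < b)%N -> s c = c.
  by move=> cb; apply/eqP; apply: contraTT cb => /min_b; rewrite -leqNgt.
have b_lt : (b < s b)%N.
  rewrite ltn_neqAle eq_sym sb leqNgt; apply/negP => sbb.
  by move/fix_below/perm_inj: (sbb) => e; rewrite e eqxx in sb.
exists (vix (setnth ord0 T b) (setnth ord0 S b)); last first.
  rewrite !pmonoE // perm1 eqxx (inj_eq (setnth_inj cS)) (negPf sb) //.
move=> k0; rewrite -(vixK k0); move: (vcol k0) (vrow k0) => i v.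
have [iT|iT] := boolP (i \in T); last by rewrite !pmono_notin.
have [c <-] := @setnth_onto _ ord0 T k i cT iT.
rewrite !pmonoE // perm1 => lt.
have [cb|bc|cb] := ltngtP c b; first by rewrite fix_below.
  have : (setnth ord0 T b < setnth ord0 T c)%N by rewrite setnth_mono.
  move: lt => /=; move: (setnth ord0 T b) (setnth ord0 T c) (setnth ord0 S b) => p q w.
  move=> h1 h2; have := leq_mul h2 (leqnn n); have := ltn_ord w; lia.
move/val_inj: cb lt => ->; rewrite /= ltn_add2l => lt.
rewrite -!val_eqE /= !gtn_eqF //; apply: ltn_trans lt _.
by rewrite setnth_mono.
Qed.

Lemma gminor_supp k S T x : #|S| = k -> #|T| = k -> x \in msupp (gminor Xmx S T) ->
  exists s : 'S_k, x = pmono S T s.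
Proof.
move=> cS cT; rewrite (gminor_Xmx cS cT) mcoeff_msupp raddf_sum /= => nz.
have [s /eqP e|no] := pickP (fun s : 'S_k => x == pmono S T s); first by exists s.
case/negP: nz; rewrite big1 // => s _.
by rewrite mcoeffZ mcoeffX eq_sym no mulr0.
Qed.

Lemma gminor_lead k S T : #|S| = k -> #|T| = k ->
  mlead (gminor Xmx S T) = pmono S T (1%g : 'S_k) /\ mleadc (gminor Xmx S T) = 1.
Proof.
move=> cS cT; have c1 : (gminor Xmx S T)@_(pmono S T (1%g : 'S_k)) = 1.
  rewrite (gminor_Xmx cS cT) raddf_sum /= (bigD1 1%g) //= big1.
    by rewrite odd_perm1 scale1r mcoeffX eqxx addr0.
  by move=> s s1; rewrite mcoeffZ mcoeffX (lt_eqF (pmono_lt _ _ s1)) ?mulr0.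
suff e : mlead (gminor Xmx S T) = pmono S T (1%g : 'S_k) by rewrite e.
apply: mleadP; first by rewrite c1 oner_neq0.
move=> x /(gminor_supp cS cT)[s ->]; have [->//|s1] := eqVneq s 1%g.
by apply/ltW/pmono_lt.
Qed.

Lemma colsumD x y i : colsum (x + y)%MM i = (colsum x i + colsum y i)%N.
Proof. by rewrite /colsum -big_split; apply: eq_bigr => v _; rewrite mnmDE. Qed.

Lemma colsum0 i : colsum (0%MM : 'X_{1..N}) i = 0%N.
Proof. by rewrite /colsum big1 // => v _; rewrite mnm0E. Qed.

Variable m : nat.
Notation tix := {ffun 'I_m -> {set 'I_n}}.
Implicit Types (A B : tix).

Lemma gminor_colsum S T x i : x \in msupp (gminor Xmx S T) -> colsum x i = (i \in T).
Proof.
have [cST|] := eqVneq #|S| #|T|; last by move/gminor_card->; rewrite msupp0.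
by move/(gminor_supp cST erefl) => [s ->]; apply: colsum_pmono.
Qed.

Lemma prod_gminor_colsum A B x i : x \in msupp (\prod_j gminor Xmx (A j) (B j)) ->
  colsum x i = mult B i.
Proof.
have -> : mult B i = (\sum_j (i \in B j))%N.
  by rewrite /mult -sum1_card big_mkcond; apply: eq_bigr => j _; rewrite inE; case: (_ \in _).
pose Q (d : nat) (p : R) := forall x, x \in msupp p -> colsum x i = d.
move: x; change (Q (\sum_j (i \in B j))%N (\prod_j gminor Xmx (A j) (B j))).
apply: (big_ind2 Q) => [x|d p d' p' Qp Qp' x|j _ x].
- by rewrite msupp1 inE => /eqP->; rewrite colsum0.
- by move/msuppM_le/allpairsP => [[a b] /= [/Qp <- /Qp' <- ->]]; rewrite colsumD.
- exact: gminor_colsum.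
Qed.

(** The coordinate at [A] of the generic matrix applied to [w], as a polynomial in the matrix
    entries. *)
Definition coordpoly (w : tix -> K) A : R := gact Xmx (fun B => (w B)%:MP) A.

Lemma subst_coordpoly w A G : subst (coordpoly w A) G = gact G (fun B => (w B)%:MP) A.
Proof.
rewrite /subst (gact_map (comp_mpoly [tuple G (vrow k) (vcol k) | k < N])).
have -> : map_mx (comp_mpoly [tuple G (vrow k) (vcol k) | k < N]) Xmx = G.
  by apply/matrixP => v i; rewrite !mxE comp_mpolyXU -tnth_nth tnth_mktuple vrowE vcolE.
by apply: eq_gact => B; rewrite /= comp_mpolyC.
Qed.

Lemma map_Xmx (e : 'I_N -> K) : map_mx (meval e) Xmx = mx_of e.
Proof. by apply/matrixP => v i; rewrite !mxE mevalXU. Qed.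

Lemma coordpoly_eval w A (e : 'I_N -> K) :
  (coordpoly w A).@[e] = gact (mx_of e) w A.
Proof.
rewrite (gact_map (meval e)) map_Xmx.
by apply: eq_gact => B; rewrite /= mevalC.
Qed.

Definition primitive (la : seq nat) (w : tix -> K) :=
  (forall A, w A != 0 -> forall i, mult A i = nth 0%N la i) /\
  (forall i A, gact (raise K n' i) w A = w A).

(** The weight of [w] gives the degree in each column. Multiplying the generic matrix on the right
    by [raise] amounts to applying [raise] to [w] first, which fixes [w]. *)
Lemma coordpoly_Uinvariant la w A : primitive la w -> Uinvariant la (coordpoly w A).
Proof.
move=> [wt inv]; split => [x|i G].
  rewrite /coordpoly /gact => /msupp_sum_le /flattenP[_ /mapP[B _ ->]] xs i.
  have [w0|w0] := eqVneq (w B) 0; first by move: xs; rewrite w0 mpolyC0 mulr0 msupp0.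
  rewrite -(wt _ w0); apply: (@prod_gminor_colsum A B).
  by move: xs; rewrite mulrC mul_mpolyC; apply: msuppZ_le.
rewrite !subst_coordpoly gactM; apply: eq_gact => B.
rewrite -(raise_map (@mpolyC N K)) -[RHS]/(mpolyC _ _) -(inv i B).
by rewrite (gact_map (@mpolyC N K)).
Qed.

End Bideterminants.

(** * Semistandard tableaux and the spanning property of bideterminants *)

Section Tableau.
Variables (K : fieldType) (n' : nat) (la : seq nat).
Notation n := n'.+1.
Notation N := (n * n)%N.
Notation R := {mpoly K[N]}.
Notation hw := (hwidx n' la).
Hypothesis la_sorted : sorted geq la.

Definition bidet (A : tidx n la) : R := coordpoly (pure K hw) A.

Lemma bidetE A : bidet A = \prod_j gminor (Xmx K n') (A j) (hw j).
Proof.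
rewrite /bidet /coordpoly -gact_pure; apply: eq_gact => B.
by rewrite /pure rmorph_nat.
Qed.

Lemma pure_primitive : primitive la (pure K hw).
Proof.
split => [A|i A]; last by rewrite gact_raise_pure //; apply: hwidx_initial.
rewrite /pure; case: (eqVneq A hw) => [-> _ i|_]; first exact: mult_hwidx.
by rewrite eqxx.
Qed.

Section Semistandard.
Variable M : 'X_{1..N}.
Hypothesis M_col : forall i, colsum M i = nth 0%N la i.
Hypothesis M_std : forall i i1 x0 : 'I_n, i1 = i.+1 :> nat ->
  (\sum_(v : 'I_n | v <= x0) M (vix i1 v) <= \sum_(v : 'I_n | v < x0) M (vix i v))%N.

Let cum (i v : 'I_n) : nat := (\sum_(u : 'I_n | u <= v) M (vix i u))%N.

(* The entry in row i and column j of the tableau whose i-th row is weakly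
   increasing with M (vix i v) entries equal to v. *)
Let tab (i : 'I_n) (j : nat) : 'I_n := [arg min_(v < ord_max | (j < cum i v)%N) (v : nat)].

Let leq_cum i (v u : 'I_n) : (v <= u)%N -> (cum i v <= cum i u)%N.
Proof.
move=> vu; rewrite /cum big_mkcond [X in (_ <= X)%N]big_mkcond; apply: leq_sum => t _.
by case: (leqP t v) => // tv; rewrite (leq_trans tv vu).
Qed.

Let cum_max i : cum i ord_max = nth 0%N la i.
Proof.
by rewrite -M_col /cum /colsum; apply: eq_bigl => u; rewrite -ltnS ltn_ord.
Qed.

Let tab_le (i : 'I_n) j (v : 'I_n) : (j < nth 0 la i)%N -> (tab i j <= v)%N = (j < cum i v)%N.
Proof.
move=> ji; rewrite /tab; case: arg_minnP; first by rewrite cum_max.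
move=> t jt tmin; apply/idP/idP => [tv|]; last exact: tmin.
exact: leq_trans jt (leq_cum _ tv).
Qed.

(** Strictness down the columns: row [i1] has more than [j] entries at most [tab i1 j], so by
    [M_std] row [i] has more than [j] entries strictly smaller than [tab i1 j]. *)
Let tab_ltS (i i1 : 'I_n) j : i1 = i.+1 :> nat -> (j < nth 0 la i1)%N ->
  (tab i j < tab i1 j)%N.
Proof.
move=> i1E ji1; have ji : (j < nth 0 la i)%N.
  by apply: leq_trans ji1 _; apply: nth_sorted_geq => //; rewrite i1E leqnSn.
have : (j < cum i1 (tab i1 j))%N by rewrite -tab_le.
move=> /leq_trans/(_ (M_std (tab i1 j) i1E)).
case: (tab i1 j) => [[|t] ht] /=; first by rewrite big_pred0 // => v; rewrite ltn0.
have ht' : (t < n)%N by apply: ltnW.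
rewrite (eq_bigl (fun v : 'I_n => (v <= Ordinal ht')%N)) // -/(cum i (Ordinal ht')).
by rewrite -tab_le // => le; rewrite ltnS.
Qed.

Let tab_lt (i i1 : 'I_n) j : (i < i1)%N -> (j < nth 0 la i1)%N -> (tab i j < tab i1 j)%N.
Proof.
case: i1 => [i1 hi1] /=; elim: i1 hi1 => [//|i1 IH] hi1; rewrite ltnS leq_eqVlt.
have hi1' : (i1 < n)%N by apply: ltnW.
case/orP => [/eqP e|lt] ji; first by apply: tab_ltS => //=; rewrite e.
have ji' : (j < nth 0 la i1)%N by apply: leq_trans ji (nth_sorted_geq _ _).
apply: ltn_trans (IH hi1' lt ji') _.
exact: (@tab_ltS (Ordinal hi1') (Ordinal hi1)).
Qed.

Let tabidx : tidx n la := [ffun j : 'I_(ncols la) => [set tab i j | i in hw j]].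

Let enum_tabidx j : enum (tabidx j) = [seq tab i j | i <- enum (hw j)].
Proof.
apply: enum_set_sorted => [|v].
  have := sorted_enum_set (hw j); apply: (homo_sorted_in (P := mem (hw j))).
    move=> i i1; rewrite /= ffunE !inE => _ ji1 lt; exact: tab_lt.
  by apply/allP => i; rewrite mem_enum.
rewrite [tabidx j]ffunE; apply/mapP/imsetP => [] [i] ij ->.
  by exists i; rewrite // -mem_enum.
by exists i; rewrite ?mem_enum.
Qed.

Let card_tabidx j : #|tabidx j| = #|hw j|.
Proof. by rewrite cardE enum_tabidx size_map -cardE. Qed.

Let pmono_tabidx j : pmono (tabidx j) (hw j) (1%g : 'S_#|hw j|) =
  (\sum_(i in hw j) U_(vix i (tab i j)))%MM.
Proof.
rewrite /pmono -[RHS]big_enum (big_nth ord0) -cardE big_mkord.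
apply: eq_bigr => b _; rewrite perm1 /setnth enum_tabidx.
by rewrite (nth_map ord0) // -cardE.
Qed.

Let count_le (i v : 'I_n) :
  (\sum_(u : 'I_n | u <= v) \sum_(j < ncols la | j < nth 0 la i) (tab i j == u) = cum i v)%N.
Proof.
rewrite exchange_big /=.
have ci : (cum i v <= ncols la)%N.
  apply: leq_trans (leq_cum i (leq_ord v : (v <= ord_max)%N)) _.
  by rewrite cum_max; apply: nth_sorted_geq.
transitivity (\sum_(j < ncols la | (j < cum i v)%N) 1)%N; last first.
  by rewrite (big_ord_narrow ci) sum1_card card_ord.
rewrite big_mkcond [RHS]big_mkcond; apply: eq_bigr => j _.
case: (ltnP j (nth 0%N la i)) => ji; last first.
  rewrite ltnNge (leq_trans _ ji) //.
  by rewrite -cum_max leq_cum // leq_ord.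
rewrite -tab_le //; case: leqP => tv.
  by rewrite (bigD1 (tab i j)) //= eqxx big1 // => u /andP[_ /negPf]; rewrite eq_sym => ->.
rewrite big1 // => u uv; apply/eqP; rewrite eqb0; apply: contraTneq uv => <-.
by rewrite -ltnNge.
Qed.

Let count_tab (i v : 'I_n) :
  (\sum_(j < ncols la | j < nth 0 la i) (tab i j == v) = M (vix i v))%N.
Proof.
case: v => v hv; elim/ltn_ind: v hv => v IH hv.
have := count_le i (Ordinal hv); rewrite /cum.
rewrite (bigD1 (Ordinal hv)) //= [X in _ = X -> _](bigD1 (Ordinal hv)) //=.
rewrite [X in (_ + X)%N = _](eq_bigr (fun u => M (vix i u))); first by move/addIn.
move=> [u hu] /= /andP[le ne]; apply: IH.
by rewrite ltn_neqAle le andbT.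
Qed.

(** The leading monomial of each minor is its diagonal term; over all columns of the tableau these
    multiply to its row content, which is [M]. *)
Lemma bidet_lead : exists A, mlead (bidet A) = M /\ mleadc (bidet A) = 1.
Proof.
have lead j : mlead (gminor (Xmx K n') (tabidx j) (hw j)) =
    (\sum_(i in hw j) U_(vix i (tab i j)))%MM.
  have [-> _] := @gminor_lead K n' #|hw j| _ _ (card_tabidx j) erefl.
  exact: pmono_tabidx.
have leadc j : mleadc (gminor (Xmx K n') (tabidx j) (hw j)) = 1.
  by have [_ ->] := @gminor_lead K n' #|hw j| _ _ (card_tabidx j) erefl.
exists tabidx; rewrite bidetE.
have e : mlead (\prod_j gminor (Xmx K n') (tabidx j) (hw j)) =
    (\sum_j mlead (gminor (Xmx K n') (tabidx j) (hw j)))%MM.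
  apply: mlead_prod => j _ _; apply/eqP => p0.
  by have /eqP := leadc j; rewrite p0 mcoeff0 eq_sym oner_eq0.
split; last by rewrite e mleadc_prod big1.
rewrite e; apply/mnmP => k; rewrite -(vixK k); move: (vcol k) (vrow k) => i v.
rewrite -count_tab mnm_sumE [RHS]big_mkcond; apply: eq_bigr => j _.
rewrite lead mnm_sumE; case: ifP => ji.
  rewrite (bigD1 i) /=; last by rewrite ffunE inE.
  rewrite mnm1E eq_vix eqxx big1 ?addn0 // => l /andP[_ /negPf li].
  by rewrite mnm1E eq_vix li.
rewrite big1 // => l; rewrite ffunE inE => jl; rewrite mnm1E eq_vix.
by case: eqP => // li; rewrite -li jl in ji.
Qed.

End Semistandard.

Lemma Uinvariant_sub c P Q : Uinvariant la P -> Uinvariant la Q ->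
  Uinvariant la (P - c *: Q : R).
Proof.
move=> [dP iP] [dQ iQ]; split => [x|i G].
  by move/msuppB_le; rewrite mem_cat => /orP[/dP|/msuppZ_le/dQ].
by rewrite /subst !comp_mpolyB !comp_mpolyZ -!/(subst _ _) iP iQ.
Qed.

(** Well-founded induction on the leading monomial: it is also that of some bideterminant, with
    coefficient 1, and subtracting a multiple of the latter cancels it and preserves invariance. *)
Lemma Uinvariant_bidet P : Uinvariant la P ->
  exists c : tidx n la -> K, P = \sum_A c A *: bidet A.
Proof.
move: {2}(mlead P) (erefl (mlead P)) => x.
elim/(well_founded_ind (@ltom_wf N)): x P => x IH P Px UP.
have [->|P0] := eqVneq P 0.
  by exists (fun=> 0); rewrite big1 // => A _; rewrite scale0r.
have [A [lA cA]] := bidet_lead (M := mlead P)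
  (fun i => UP.1 _ (mlead_supp P0) i)
  (fun i i1 x0 i1E => lead_semistandard x0 i1E UP P0).
pose Q := P - mleadc P *: bidet A.
have UQ : Uinvariant la Q.
  by apply: Uinvariant_sub => //; apply: coordpoly_Uinvariant; apply: pure_primitive.
suff [c e] : exists c, Q = \sum_A c A *: bidet A.
  exists (fun B => c B + mleadc P *+ (B == A)).
  under eq_bigr do rewrite scalerDl.
  rewrite big_split /= -e (bigD1 A) //= big1 => [|B /negPf->]; last by rewrite scale0r.
  by rewrite eqxx addr0 subrK.
have [->|Q0] := eqVneq Q 0.
  by exists (fun=> 0); rewrite big1 // => B _; rewrite scale0r.
apply: (IH (mlead Q)) => //; rewrite -Px lt_neqAle; apply/andP; split.
  apply/eqP => e; have := mleadc_eq0 Q; rewrite (negPf Q0) e mcoeffB mcoeffZ.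
  by rewrite -{3}lA cA mulr1 subrr eqxx.
have /msuppB_le := mlead_supp Q0; rewrite mem_cat => /orP[|/msuppZ_le].
  exact: msupp_le_mlead.
by rewrite -lA; apply: msupp_le_mlead.
Qed.

End Tableau.

(** * Homomorphisms and primitive vectors *)

(** [P] and [Q] are predicates and [L] is injective only on [P], so bases are transported
    explicitly: by images in one direction, by chosen preimages in the other. *)
Lemma has_dim_iso (K : fieldType) (vT vT' : vectType K) (P : vT -> Prop)
    (Q : vT' -> Prop) (L : {linear vT -> vT'}) :
  P 0 -> (forall a u v, P u -> P v -> P (a *: u + v)) ->
  (forall u, P u -> Q (L u)) -> (forall u, P u -> L u = 0 -> u = 0) ->
  (forall v, Q v -> exists2 u, P u & L u = v) ->
  forall d, has_dim K vT P d <-> has_dim K vT' Q d.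
Proof.
move=> P0 PD PQ Pinj Qsurj d.
have Psum (X : d.-tuple vT) (c : 'I_d -> K) : (forall x, x \in X -> P x) ->
    P (\sum_(i < d) c i *: X`_i).
  move=> PX; apply: (big_ind P) => // [u v Pu Pv|i _].
    by rewrite -[u]scale1r; apply: PD.
  by rewrite -[_ *: _]addr0; apply: PD => //; apply: PX; rewrite mem_nth ?size_tuple.
split=> [[X [freeX PX spanX]]|[Y [freeY QY spanY]]].
  pose Y := map_tuple L X.
  have YE (c : 'I_d -> K) : \sum_(i < d) c i *: Y`_i = L (\sum_(i < d) c i *: X`_i).
    rewrite linear_sum; apply: eq_bigr => i _.
    by rewrite linearZ /= (nth_map 0) ?size_tuple.
  exists Y; split=> [|y|v Qv].
  - apply/freeP => c; rewrite YE => /(Pinj _ (Psum _ c PX)).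
    by move/freeP: freeX; apply.
  - by case/mapP => x /PX Px ->; apply: PQ.
  - have [u Pu <-] := Qsurj _ Qv; rewrite (coord_span (spanX _ Pu)) -YE.
    apply: memv_suml => i _; rewrite memvZ // memv_span // mem_nth //.
    by rewrite size_tuple.
have [f fP] : exists f : 'I_d -> vT, forall i, P (f i) /\ L (f i) = tnth Y i.
  apply: (@fin_all_exists _ (fun=> vT) (fun i u => P u /\ L u = tnth Y i)) => i.
  have [u Pu Lu] := Qsurj _ (QY _ (mem_tnth i Y)).
  by exists u.
pose X := [tuple f i | i < d].
have XE (i : 'I_d) : X`_i = f i by rewrite -tnth_nth tnth_mktuple.
have YE (c : 'I_d -> K) : L (\sum_(i < d) c i *: X`_i) = \sum_(i < d) c i *: Y`_i.
  rewrite linear_sum; apply: eq_bigr => i _.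
  by rewrite linearZ /= XE (fP i).2 (tnth_nth 0).
have PX x : x \in X -> P x by case/tnthP => i ->; rewrite tnth_mktuple; case: (fP i).
exists X; split=> // [|u Pu].
  apply/freeP => c e; have := YE c; rewrite e linear0 => /esym.
  by move/freeP: freeY; apply.
have Lu := coord_span (spanY _ (PQ _ Pu)).
suff -> : u = \sum_(i < d) coord Y i (L u) *: X`_i.
  apply: memv_suml => i _; rewrite memvZ // memv_span // mem_nth //.
  by rewrite size_tuple.
apply/eqP; rewrite -subr_eq0; apply/eqP/Pinj.
  rewrite addrC -scaleN1r; apply: PD => //; exact: Psum.
by rewrite linearB /= YE -Lu subrr.
Qed.

Section HomPrimitive.
Variables (K : fieldType) (n' : nat).
Notation n := n'.+1.
Hypothesis Kinf : forall s : seq K, exists x : K, x \notin s.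
Variables la mu : seq nat.
Hypothesis la_sorted : sorted geq la.
Notation actl := (act K n la).
Notation actm := (act K n mu).
Notation Wl := (Weyl K n la).
Notation Wm := (Weyl K n mu).
Notation zl := (hwvec K n' la).

Definition Prim (v : amb K n mu) : Prop := v \in Wm /\ primitive la v.

(** The coordinates of [g v] are combinations of those of [g z], where [z] is the highest weight
    vector, with coefficients independent of [g]; these coefficients are the matrix of [C]. *)
Lemma Prim_extend (v : amb K n mu) : primitive la v ->
  exists C : 'Hom(amb K n la, amb K n mu), forall g, C (actl g zl) = actm g v.
Proof.
move=> prim.
have [c cE] : exists c : tidx n mu -> tidx n la -> K, forall S,
    coordpoly v S = \sum_A c S A *: bidet K A.
  apply: (@fin_all_exists _ (fun=> tidx n la -> K)
    (fun S cS => coordpoly v S = \sum_A cS A *: bidet K A)) => S; apply: Uinvariant_bidet => //.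
  exact: coordpoly_Uinvariant.
pose C (w : amb K n la) : amb K n mu := [ffun S => \sum_A c S A * w A].
have linC : linear C.
  move=> a u w; apply/ffunP => S; rewrite !ffunE scaler_sumr -big_split.
  by apply: eq_bigr => A _; rewrite !ffunE mulrDr mulrCA.
pose HC := GRing.isLinear.Build _ _ _ _ C linC.
pose CL : {linear _ -> _} := HB.pack C HC.
exists (linfun CL) => g; rewrite lfunE /=; apply/ffunP => S.
rewrite ffunE actE; pose e k : K := g (vrow k) (vcol k).
rewrite -[g]mx_ofK -/e.
have ev : (\sum_A c S A *: bidet K A).@[e] = gact (mx_of e) v S.
  by rewrite -cE coordpoly_eval.
apply: etrans ev; rewrite raddf_sum /=.
apply: eq_bigr => A _; rewrite mevalZ; congr (_ * _).
rewrite coordpoly_eval actE; apply: eq_gact => B; by rewrite ffunE.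
Qed.

Lemma det_raise i : \det (raise K n' i) = 1.
Proof.
rewrite -det_tr det_trig; first by rewrite big1 // => x _; rewrite mxE raise_diag.
by apply/is_trig_mxP => x y xy; rewrite mxE raise_tri.
Qed.

Let zs : subvs_of Wl := Subvs (mem_Weyl_hwvec K n' la).

Lemma expr_inj a b : (forall t : K, t != 0 -> t ^+ a = t ^+ b) -> a = b.
Proof.
move=> e; apply/eqP; apply: contraT => ab.
(* The factor ['X] forces the nonroot to be nonzero. *)
have q0 : ('X^a - 'X^b) * 'X != 0 :> {poly K}.
  rewrite mulf_neq0 ?polyX_eq0 // subr_eq0; apply: contra ab => /eqP.
  move/(congr1 (fun q : {poly K} => q`_a)); rewrite !coefXn eqxx.
  by case: eqP => // _ /eqP; rewrite oner_eq0.
have [t] := poly_nonroot Kinf q0; rewrite !hornerE mulf_eq0 negb_or.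
by case/andP => ne t0; rewrite (e _ t0) subrr eqxx in ne.
Qed.

(** The weight is read off from the diagonal matrices that scale a single basis vector; the raising
    matrices fix the highest weight vector, hence also its image. *)
Lemma Shom_primitive f : is_Shom K n la mu f -> Prim (vsval (f zs)).
Proof.
move=> hf; split; first exact: subvsP.
split=> [S wS i|i S].
  rewrite -mult_hwidx //; apply: expr_inj => t t0.
  pose d (x : 'I_n) := if x == i then t else 1.
  have d0 x : d x != 0 by rewrite /d; case: ifP => _ //; apply: oner_neq0.
  pose g := diag_mx (\row_x d x).
  have gE x y : g x y = d x *+ (x == y) by rewrite !mxE.
  have gU : g \in unitmx.
    by rewrite unitmxE det_diag unitfE; apply/prodf_neq0 => x _; rewrite mxE.
  have dprod (e : 'I_n -> nat) : \prod_x d x ^+ e x = t ^+ e i.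
    rewrite (bigD1 i) //= big1 ?mulr1; first by rewrite /d eqxx.
    by move=> x /negPf xi; rewrite /d xi expr1n.
  have e : vsval (t ^+ mult (hwidx n' la) i *: zs) = actl g (vsval zs).
    apply/ffunP => A; rewrite actE (gact_diag _ _ gE) !ffunE prod_mult dprod.
    by rewrite /pure; case: eqP => [->|] //; rewrite !scaler0 mulr0.
  have /ffunP/(_ S) := hf g gU zs _ e.
  rewrite linearZ /= actE (gact_diag _ _ gE) ffunE prod_mult dprod.
  by move/(mulIf wS).
have e : vsval zs = actl (raise K n' i) (vsval zs).
  apply/ffunP => A; rewrite actE.
  transitivity (gact (raise K n' i) (pure K (hwidx n' la)) A).
    by rewrite gact_raise_pure ?ffunE //; apply: hwidx_initial.
  by apply: eq_gact => B; rewrite ffunE.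
have gU : raise K n' i \in unitmx by rewrite unitmxE det_raise unitr1.
by have /ffunP/(_ S) := hf _ gU zs _ e; rewrite actE.
Qed.

(** The kernel contains the orbit under invertible matrices, and this spans the Weyl module because
    the generic determinant is a nonzero polynomial. *)
Lemma Shom_inj f : is_Shom K n la mu f -> vsval (f zs) = 0 -> f = 0.
Proof.
move=> hf fz; apply/lfunP => u; rewrite lfunE /=.
pose F : {linear amb K n la -> amb K n mu} := (vsval \o (f \o vsproj Wl)).
have sub : (Wl <= lker (linfun F))%VS.
  apply: (Weyl_sub Kinf (q := \det (Xmx K n'))).
    apply/eqP => /(congr1 (meval (fun k => (1%:M : 'M[K]_n) (vrow k) (vcol k)))).
    rewrite meval0 -det_map_mx map_Xmx mx_ofK.
    by rewrite det1 => /eqP; rewrite oner_eq0.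
  move=> e de; have gU : mx_of e \in unitmx.
    by move: de; rewrite unitmxE unitfE -det_map_mx map_Xmx.
  rewrite memv_ker lfunE /=.
  have -> : vsval (f (vsproj Wl (actl (mx_of e) zl))) = actm (mx_of e) (vsval (f zs)).
    by apply: hf => //; rewrite vsprojK // mem_Weyl_act.
  by rewrite fz linear0.
have := subvP sub _ (subvsP u); rewrite memv_ker lfunE /= vsvalK => /eqP fu.
by apply: val_inj; rewrite /= fu.
Qed.

(** The map from [Prim_extend] takes the orbit of the highest weight vector to that of [v], so that
    its image and its equivariance can be checked on the orbit. *)
Lemma Shom_surj v : Prim v -> exists2 f, is_Shom K n la mu f & vsval (f zs) = v.
Proof.
move=> [vW prim]; have [C CE] := Prim_extend prim.
pose F : {linear subvs_of Wl -> subvs_of Wm} := (vsproj Wm \o (C \o vsval)).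
have FE u : vsval (F u) = C (vsval u).
  rewrite /= vsprojK //.
  apply: (mem_Weyl_linear Kinf (f := C) _ (subvsP u)) => g.
  by rewrite /= CE; apply: Weyl_stable.
exists (linfun F) => [g _ u u' e|].
  rewrite !lfunE !FE e.
  apply: (Weyl_ext Kinf (f := C \o act K n la g) (f' := act K n mu g \o C) _ (subvsP u)).
  by move=> h; rewrite /= CE -!act_mul CE.
rewrite lfunE FE /=.
have act1 nu w : act K n nu 1%:M w = w by apply/ffunP => S; rewrite actE gact1.
by rewrite -[zl]act1 CE act1.
Qed.

Lemma dimHom_Prim e : dimHom_is K n la mu e <-> has_dim K (amb K n mu) Prim e.
Proof.
pose ev (f : 'Hom(subvs_of Wl, subvs_of Wm)) : amb K n mu := vsval (f zs).
have linev : linear ev by move=> a f h; rewrite /ev add_lfunE scale_lfunE linearP.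
pose evL : {linear _ -> _} := HB.pack ev (GRing.isLinear.Build _ _ _ _ ev linev).
apply: (@has_dim_iso _ _ _ _ _ evL) => //=.
- by move=> g gU u v _; rewrite !lfunE /= linear0.
- move=> a f h hf hh g gU u v e'.
  rewrite !add_lfunE !scale_lfunE !linearP /=.
  by rewrite (hf g gU u v e') (hh g gU u v e').
- exact: Shom_primitive.
- exact: Shom_inj.
- exact: Shom_surj.
Qed.

End HomPrimitive.

(** * Relations in Weyl modules *)

Section WeylRelations.
Variables (K : fieldType) (n' : nat).
Notation n := n'.+1.
Hypothesis Kinf : forall s : seq K, exists x : K, x \notin s.
Variable nu : seq nat.
Notation W := (Weyl K n nu).
Notation hw := (hwidx n' nu).
Notation z := (hwvec K n' nu).
Notation act := (act K n nu).

(** Linear relations between coordinates need only be checked on the orbit, where coordinates are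
    products of minors. *)
Lemma Weyl_lincomb (I : finType) (P : pred I) (c : I -> K) (t : I -> tidx n nu) :
  (forall g, \sum_(i | P i) c i * act g z (t i) = 0) ->
  forall w, w \in W -> \sum_(i | P i) c i * w (t i) = 0.
Proof.
move=> h w wW.
pose f (w : amb K n nu) : K^o := \sum_(i | P i) c i * w (t i).
have linf : linear f.
  move=> a u v; rewrite /f scaler_sumr -big_split; apply: eq_bigr => i _.
  by rewrite !ffunE mulrDr mulrCA.
pose fL : {linear _ -> _} := HB.pack f (GRing.isLinear.Build _ _ _ _ f linf).
suff : fL w \in 0%VS by rewrite memv0 => /eqP.
by apply: (mem_Weyl_linear Kinf (f := fL) _ wW) => g; rewrite memv0; apply/eqP/h.
Qed.

Lemma Weyl_card w (S : tidx n nu) j : w \in W -> #|S j| != #|hw j| -> w S = 0.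
Proof.
move=> wW ne; have := @Weyl_lincomb unit xpredT (fun=> 1) (fun=> S) _ _ wW.
rewrite big_const card_unit /= mul1r addr0; apply => g.
by rewrite big1 // => _ _; rewrite act_hwvec (bigD1 j) //= gminor_card // mul0r mulr0.
Qed.

Lemma setnth_D1 (U : {set 'I_n}) k (a : 'I_k.+1) (i : 'I_k) : #|U| = k.+1 ->
  setnth ord0 (U :\ setnth ord0 U a) i = setnth ord0 U (lift a i).
Proof.
move=> cU; pose s := [seq setnth ord0 U (lift a i) | i <- enum 'I_k].
have es : enum (U :\ setnth ord0 U a) = s.
  apply: enum_set_sorted => [|x].
    apply: (homo_sorted (e := relpre (val : 'I_k -> nat) ltn)); last first.
      by rewrite -sorted_map val_enum_ord iota_ltn_sorted.
    move=> i1 i2 /= lt; rewrite setnth_mono //= /bump; lia.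
  rewrite !inE; apply/mapP/andP => [[b _ ->]|[xa xU]].
    by rewrite mem_setnth // (inj_eq (setnth_inj cU)) eq_sym neq_lift.
  have [c xE] := @setnth_onto _ ord0 U _ x cU xU.
  have : c != a by apply: contra xa => /eqP <-; rewrite xE.
  rewrite eq_sym => /unlift_some [b cE _]; exists b; first by rewrite mem_enum.
  by rewrite -cE xE.
by rewrite [LHS]/setnth es (nth_map i) ?size_enum_ord // nth_ord_enum.
Qed.

(* Laplace expansion of a determinant with a repeated column. *)
Lemma gminor_exchange (g : 'M[K]_n) (U T : {set 'I_n}) : ord0 \in T ->
  \sum_(x in U) (-1) ^+ index x (enum U) * (g x ord0 * gminor g (U :\ x) T) = 0.
Proof.
move=> T0; have [cU|cU] := eqVneq #|U| #|T|.+1; last first.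
  rewrite big1 // => x xU; rewrite gminor_card ?mulr0 //.
  by apply: contra cU; rewrite (cardsD1 x U) xU => /eqP ->.
pose M : 'M[K]_(#|T|.+1) := \matrix_(a, j)
  g (setnth ord0 U a) (if unlift ord0 j is Some b then setnth ord0 T b else ord0).
have [b0 b0E] := @setnth_onto _ ord0 T _ ord0 erefl T0.
have detM : \det M = 0.
  rewrite -det_tr (@determinant_alternate _ _ _ ord0 (lift ord0 b0)) //.
  by move=> a; rewrite !mxE unlift_none liftK b0E.
rewrite -[RHS]detM (expand_det_col _ ord0).
rewrite -[LHS]big_enum (big_nth ord0) -cardE cU big_mkord.
apply: eq_bigr => a _; rewrite mxE unlift_none /cofactor addn0.
rewrite index_uniq ?enum_uniq -?cardE ?cU // -/(setnth ord0 U a) mulrCA.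
rewrite (@gminorE _ _ #|T|) //; last first.
  by have := cardsD1 (setnth ord0 U a) U; rewrite mem_setnth // cU add1n => -[].
congr (_ * (_ * \det _)); apply/matrixP => i j; rewrite !mxE setnth_D1 //.
by rewrite liftK.
Qed.

Definition upd (S : tidx n nu) (c c' : 'I_(ncols nu)) (X Y : {set 'I_n}) : tidx n nu :=
  [ffun j => if j == c then X else if j == c' then Y else S j].

(** On the orbit the columns other than [c] and [c'] give a common factor, and what is left is the
    sum in [gminor_exchange]. *)
Lemma Weyl_exchange w S c c' (U : {set 'I_n}) : w \in W -> c != c' ->
  ord0 \in hw c -> hw c' = [set ord0] ->
  \sum_(x in U) (-1) ^+ index x (enum U) * w (upd S c c' (U :\ x) [set x]) = 0.
Proof.
move=> wW cc' hc hc'; apply: Weyl_lincomb => // g.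
pose D := \prod_(j | (j != c) && (j != c')) gminor g (S j) (hw j).
transitivity (D * \sum_(x in U) (-1) ^+ index x (enum U) *
    (g x ord0 * gminor g (U :\ x) (hw c))); last by rewrite gminor_exchange ?mulr0.
rewrite mulr_sumr; apply: eq_bigr => x _; rewrite act_hwvec (bigD1 c) //=.
rewrite (bigD1 c') /=; last by rewrite eq_sym.
have hx : gminor g (upd S c c' (U :\ x) [set x] c') (hw c') = g x ord0.
  by rewrite ffunE eq_sym (negPf cc') eqxx hc' gminor_set1.
rewrite hx [upd _ _ _ _ _ c]ffunE eqxx (eq_bigr (fun j => gminor g (S j) (hw j))).
  by rewrite -/D [X in _ * X = _]mulrCA [RHS]mulrC -!mulrA.
by move=> j /andP[jc jc']; rewrite ffunE (negPf jc) (negPf jc').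
Qed.

End WeylRelations.

(** * Weight components *)

Section WeightProjection.
Variables (K : fieldType) (n' : nat).
Notation n := n'.+1.
Hypothesis Kinf : forall s : seq K, exists x : K, x \notin s.
Variable nu : seq nat.
Notation W := (Weyl K n nu).

Definition multmon (S : tidx n nu) : 'X_{1..n} := [multinom mult S i | i < n].

Definition wproj (x : 'X_{1..n}) (w : amb K n nu) : amb K n nu :=
  [ffun S => if multmon S == x then w S else 0].

(** The weight components of [w] are the coefficients of the polynomial map that applies a variable
    diagonal matrix to [w]. *)
Lemma mem_wproj x w : w \in W -> wproj x w \in W.
Proof.
move=> wW; pose r := undup [seq multmon A | A <- enum {: tidx n nu}].
have [xr|xr] := boolP (x \in r); last first.
  have -> : wproj x w = 0; last exact: mem0v.
  apply/ffunP => S; rewrite !ffunE; case: eqP => // e.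
  by rewrite mem_undup -e map_f // mem_enum in xr.
apply: (@mem_coefficients _ Kinf _ _ W 1 r (wproj^~ w)) => //.
- exact: oner_neq0.
- exact: undup_uniq.
move=> e _; suff -> : \sum_(y <- r) (\prod_i e i ^+ y i) *: wproj y w =
    act K n nu (diag_mx (\row_i e i)) w by apply: Weyl_stable.
apply/ffunP => S; rewrite actE (@gact_diag _ _ _ e); last by move=> i j; rewrite !mxE.
rewrite sum_ffunE prod_mult.
rewrite (eq_bigr (fun y : 'X_{1..n} =>
    if multmon S == y then (\prod_i e i ^+ y i) * w S else 0)); last first.
  by move=> y _; rewrite !ffunE; case: eqP => _ //; rewrite scaler0.
rewrite -big_mkcond (eq_bigl (pred1 (multmon S))) => [|y]; last by rewrite /= eq_sym.
rewrite -big_filter filter_pred1_uniq ?undup_uniq ?mem_undup ?map_f ?mem_enum //.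
rewrite big_seq1; congr (_ * _); apply: eq_bigr => i _; by rewrite mnmE.
Qed.

End WeightProjection.

(** * Adding columns of length one *)

Section ExtendColumns.
Variables (n' m b : nat).
Notation n := n'.+1.
Notation tix k := {ffun 'I_k -> {set 'I_n}}.

Definition ext (A : tix m) (B : tix b) : tix (m + b) :=
  [ffun j => match split j with inl a => A a | inr c => B c end].

Lemma ext_l A B a : ext A B (lshift b a) = A a.
Proof. by rewrite ffunE (unsplitK (inl a)). Qed.

Lemma ext_r A B c : ext A B (rshift m c) = B c.
Proof. by rewrite ffunE (unsplitK (inr c)). Qed.

Lemma ext_eta (T : tix (m + b)) :
  ext [ffun a => T (lshift b a)] [ffun c => T (rshift m c)] = T.
Proof.
by apply/ffunP => j; rewrite ffunE; case: splitP => i e; rewrite ffunE;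
  congr (T _); apply: val_inj; rewrite /= e.
Qed.

Lemma multE k (A : tix k) i : mult A i = (\sum_j (i \in A j))%N.
Proof.
rewrite /mult -sum1_card big_mkcond; apply: eq_bigr => j _; rewrite inE.
by case: (_ \in _).
Qed.

Lemma mult_ext A B i : mult (ext A B) i = (mult A i + mult B i)%N.
Proof.
by rewrite !multE big_split_ord; congr (_ + _)%N; apply: eq_bigr => j _;
  rewrite ?ext_l ?ext_r.
Qed.

Lemma gact_ext (R : comNzRingType) (g : 'M[R]_n) w A B :
  gact g w (ext A B) = \sum_(B' : tix b) (\prod_c gminor g (B c) (B' c)) *
    gact g (fun A' => w (ext A' B')) A.
Proof.
rewrite /gact; under [RHS]eq_bigr do rewrite mulr_sumr.
rewrite pair_big /=.
rewrite (reindex (fun q : tix b * tix m => ext q.2 q.1)) /=; last first.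
  exists (fun T : tix (m + b) => ([ffun c => T (rshift m c)], [ffun a => T (lshift b a)])).
    by case=> B' A' _ /=; congr (_, _); apply/ffunP => j; rewrite ffunE ?ext_l ?ext_r.
  by move=> T _; apply: ext_eta.
apply: eq_bigr => -[B' A'] _ /=; rewrite big_split_ord mulrA; congr (_ * _).
by rewrite mulrC; congr (_ * _); apply: eq_bigr => j _; rewrite ?ext_l ?ext_r.
Qed.

Definition ones : tix b := [ffun=> [set ord0]].

Definition points x (s : {set 'I_b}) : tix b :=
  [ffun c => if c \in s then [set x] else [set ord0]].

Lemma points0 x : points x set0 = ones.
Proof. by apply/ffunP => c; rewrite !ffunE inE. Qed.

Lemma prod_points (R : comNzRingType) (g : 'M[R]_n) x s :
  \prod_c gminor g (points x s c) [set ord0] =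
  g x ord0 ^+ #|s| * g ord0 ord0 ^+ (b - #|s|).
Proof.
rewrite (bigID (fun c => c \in s)) /=; congr (_ * _).
  by rewrite -prodr_const; apply: eq_bigr => c cs; rewrite ffunE cs gminor_set1.
rewrite (eq_bigr (fun=> g ord0 ord0)) => [|c cs]; last first.
  by rewrite ffunE (negPf cs) gminor_set1.
have -> : (b - #|s|)%N = #|~: s| by rewrite [RHS]cardsCs setCK card_ord.
rewrite -prodr_const.
by apply: eq_bigl => c; rewrite inE.
Qed.

Lemma mult_points x s : x != ord0 -> mult (points x s) x = #|s|.
Proof.
move=> x0; rewrite multE -sum1_card [RHS]big_mkcond; apply: eq_bigr => c _.
by rewrite ffunE; case: ifP => _; rewrite inE ?eqxx ?(negPf x0).
Qed.

Lemma mult_points0 x s : x != ord0 -> (mult (points x s) ord0 + #|s| = b)%N.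
Proof.
move=> x0; rewrite multE -sum1_card [X in (_ + X)%N]big_mkcond -big_split /=.
rewrite (eq_bigr (fun=> 1%N)) ?sum1_card ?card_ord // => c _.
by rewrite ffunE; case: ifP => _; rewrite inE ?eqxx // eq_sym (negPf x0).
Qed.

Lemma leq_mult k (A : tix k) i : (mult A i <= k)%N.
Proof. by rewrite /mult -[X in (_ <= X)%N]card_ord max_card. Qed.

End ExtendColumns.

(** From [q * 'C(k * p ^ d, q) = k * p ^ d * 'C(k * p ^ d - 1, q - 1)]: if [p] did not divide the
    coefficient, [p ^ d] would divide [q]. *)
Lemma dvdn_bin_pfactor p d k q : prime p -> (0 < q < p ^ d)%N -> (p %| 'C(k * p ^ d, q))%N.
Proof.
move=> pr_p /andP[q0 qd]; rewrite -[(p %| _)%N]negbK -prime_coprime //.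
apply/negP => co; suff : (p ^ d %| q)%N by move/(dvdn_leq q0); rewrite leqNgt qd.
rewrite -(@Gauss_dvdl _ _ 'C(k * p ^ d, q)) ?coprimeXl //.
case: q q0 {qd co} => // q _; rewrite -mul_bin_diag.
by rewrite dvdn_mulr // dvdn_mull.
Qed.

Section RaiseOne.
Variables (K : fieldType) (n' b : nat).

Lemma gminor_raise_pos i T : (0 < i)%N ->
  gminor (raise K n' i) [set ord0] T = (T == [set ord0])%:R.
Proof.
move=> i0; have [cT|cT] := eqVneq #|T| 1%N; last first.
  rewrite gminor_card ?cards1; last by rewrite eq_sym.
  by case: eqP => // e; rewrite e cards1 in cT.
have /cards1P[y ->] : #|T| == 1%N by rewrite cT.
rewrite gminor_set1 mxE (inj_eq set1_inj) eq_sym; congr (_%:R).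
by case: i i0 => // i _; rewrite /= orbF.
Qed.

Lemma gminor_raise0 (x : 'I_n'.+1) T : x = 1%N :> nat ->
  gminor (raise K n' 0) [set ord0] T = ((T == [set ord0]) || (T == [set x]))%:R.
Proof.
move=> x1; have [cT|cT] := eqVneq #|T| 1%N; last first.
  rewrite gminor_card ?cards1; last by rewrite eq_sym.
  case: eqP => [e|_]; first by rewrite e cards1 in cT.
  by case: eqP => // e; rewrite e cards1 in cT.
have /cards1P[y ->] : #|T| == 1%N by rewrite cT.
rewrite gminor_set1 mxE !(inj_eq set1_inj) [y == ord0]eq_sym; congr (_%:R).
by rewrite /= -x1 val_eqE.
Qed.

(** Row 0 of [raise K n' 0] has entries 1 in columns 0 and 1 and zeros elsewhere, so each of the [b]
    factors independently becomes one of two singletons. *)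
Lemma sum_raise0 (x : 'I_n'.+1) (F : {ffun 'I_b -> {set 'I_n'.+1}} -> K) : x = 1%N :> nat ->
  \sum_(B : {ffun 'I_b -> {set 'I_n'.+1}})
    (\prod_c gminor (raise K n' 0) (ones n' b c) (B c)) * F B =
  \sum_s F (points x s).
Proof.
move=> x1; have x0 : x != ord0 by rewrite -val_eqE /= x1.
pose ok (B : {ffun 'I_b -> {set 'I_n'.+1}}) :=
  [forall c, (B c == [set ord0]) || (B c == [set x])].
rewrite (bigID ok) /= [X in _ + X]big1 ?addr0; last first.
  move=> B /forallPn[c /negPf Bc].
  by rewrite (bigD1 c) //= ffunE (gminor_raise0 _ x1) Bc !mul0r.
rewrite (reindex_onto (points x) (fun B => [set c | B c == [set x]])) /=; last first.
  move=> B /forallP okB; apply/ffunP => c; rewrite ffunE inE.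
  case: (eqVneq (B c) [set x]) => [->//|Bx].
  by have := okB c; rewrite (negPf Bx) orbF => /eqP.
apply: eq_big => [s|s /andP[/forallP oks _]].
  apply/andP; split.
    by apply/forallP => c; rewrite ffunE; case: ifP; rewrite eqxx ?orbT.
  apply/eqP/setP => c; rewrite inE ffunE; case: ifP; rewrite ?eqxx //.
  by rewrite (inj_eq set1_inj) eq_sym (negPf x0).
rewrite big1 ?mul1r // => c _; rewrite [ones _ _ _]ffunE (gminor_raise0 _ x1).
by rewrite oks.
Qed.

End RaiseOne.

(** * The comparison map and the raising matrices *)

Section AddColumns.
Variables (K : fieldType) (n' : nat).
Notation n := n'.+1.
Hypothesis Kinf : forall s : seq K, exists x : K, x \notin s.
Variables (mu : seq nat) (b : nat).
Hypothesis mu_sorted : sorted geq mu.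
Notation mu' := (plus_first b mu).
Notation m := (ncols mu).
Notation W := (Weyl K n mu).
Notation W' := (Weyl K n mu').
Notation ones := (ones n' b).

Lemma nth_plus_first (nu : seq nat) i :
  nth 0%N (plus_first b nu) i = (nth 0 nu i + (i == 0) * b)%N.
Proof. by case: i => [|i]; rewrite /= ?mul1n // nth_behead mul0n addn0. Qed.

(** The new columns lie beyond the first row of [mu], the longest one, so they meet only row 0. The
    number of columns of [mu'] is [m + b] by computation, which makes [ext] well typed here. *)
Lemma hwidx_plus : hwidx n' mu' = ext (hwidx n' mu) ones.
Proof.
apply/ffunP => j; rewrite [RHS]ffunE [LHS]ffunE; case: splitP => [a|c] e; rewrite ffunE;
  apply/setP => i; rewrite !inE nth_plus_first {}e.
  case: ((i : nat) =P 0%N) => [->|_]; last by rewrite addn0.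
  by rewrite mul1n (ltn_ord a) ltn_addr.
rewrite -val_eqE /=.
case: ((i : nat) =P 0%N) => [->|/eqP i0]; first by rewrite mul1n ltn_add2l ltn_ord.
rewrite addn0; apply/negbTE; rewrite -leqNgt; apply: leq_trans (leq_addr _ _).
exact: nth_sorted_geq.
Qed.

Lemma act_hwvec_plus g A B : act K n mu' g (hwvec K n' mu') (ext A B) =
  (\prod_c gminor g (B c) [set ord0]) * act K n mu g (hwvec K n' mu) A.
Proof.
rewrite !act_hwvec hwidx_plus big_split_ord [RHS]mulrC; congr (_ * _).
  by apply: eq_bigr => a _; rewrite !ext_l.
by apply: eq_bigr => c _; rewrite !ext_r ffunE.
Qed.

Definition phi (w : amb K n mu') : amb K n mu := [ffun A => w (ext A ones)].

Lemma phi_is_linear : linear phi.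
Proof. by move=> a u v; apply/ffunP => A; rewrite !ffunE. Qed.

HB.instance Definition _ := GRing.isLinear.Build K (amb K n mu') (amb K n mu) _ phi phi_is_linear.

Lemma phi_act g : phi (act K n mu' g (hwvec K n' mu')) =
  g ord0 ord0 ^+ b *: act K n mu g (hwvec K n' mu).
Proof.
apply/ffunP => A; rewrite ffunE act_hwvec_plus.
transitivity (g ord0 ord0 ^+ b * act K n mu g (hwvec K n' mu) A); last by rewrite [RHS]ffunE.
by rewrite -(points0 b ord0) prod_points cards0 subn0 expr0 mul1r.
Qed.

Lemma phi_Weyl w : w \in W' -> phi w \in W.
Proof.
apply: (mem_Weyl_linear Kinf (f := phi)) => g; rewrite /= phi_act memvZ //.
exact: mem_Weyl_act.
Qed.

(** By [phi_act] the image contains the orbit under all matrices whose entry at (0, 0) is nonzero,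
    which is a dense set. *)
Lemma phi_onto v : v \in W -> exists2 w, w \in W' & phi w = v.
Proof.
have sub : (W <= linfun phi @: W')%VS.
  apply: (Weyl_sub Kinf (q := 'X_(vix ord0 ord0))).
    by rewrite -mleadc_eq0 mleadXm mcoeffX eqxx oner_neq0.
  move=> e; rewrite mevalXU => e0; apply/memv_imgP.
  exists (e (vix ord0 ord0) ^- b *: act K n mu' (mx_of e) (hwvec K n' mu')).
    by rewrite memvZ // mem_Weyl_act.
  rewrite lfunE /= linearZ /= phi_act mxE scalerA mulVf ?scale1r //.
  by rewrite expf_neq0.
by move/(subvP sub)/memv_imgP => [w wW ->]; exists w; rewrite // lfunE.
Qed.

(** On the orbit the coordinate depends on [s] only through its size, by [prod_points]. *)
Lemma Weyl_points w A x (s s' : {set 'I_b}) : w \in W' -> #|s| = #|s'| ->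
  w (ext A (points x s)) = w (ext A (points x s')).
Proof.
move=> wW css'; apply/eqP; rewrite -subr_eq0; apply/eqP.
have := @Weyl_lincomb K n' Kinf mu' bool xpredT (fun t => (-1) ^+ t)
  (fun t => ext A (points x (if t then s' else s))) _ w wW.
rewrite big_bool /= mul1r mulN1r addrC; apply => g.
by rewrite big_bool /= mul1r mulN1r !act_hwvec_plus !prod_points css' addNr.
Qed.

(** For positive [i] row 0 of [raise K n' i] is that of the identity, so no other component
    contributes to the last [b] columns. *)
Lemma phi_raise_pos i w : (0 < i)%N ->
  phi (act K n mu' (raise K n' i) w) = act K n mu (raise K n' i) (phi w).
Proof.
move=> i0; apply/ffunP => A; rewrite ffunE !actE gact_ext (bigD1 ones) //=.
rewrite [X in _ + X]big1 ?addr0 => [|B Bone].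
  rewrite big1 ?mul1r => [|c _]; last by rewrite ffunE gminor_raise_pos ?eqxx.
  by apply: eq_gact => A'; rewrite ffunE.
have [c Bc] : exists c, B c != [set ord0].
  apply/existsP; rewrite -negb_forall; apply: contra Bone => /forallP e.
  by apply/eqP/ffunP => c; rewrite ffunE (eqP (e c)).
by rewrite (bigD1 c) //= ffunE gminor_raise_pos // (negPf Bc) !mul0r.
Qed.

End AddColumns.

(** * Primitive vectors under the comparison map *)

Section Periodicity.
Variables (K : fieldType) (n' : nat).
Notation n := n'.+1.
Hypothesis Kinf : forall s : seq K, exists x : K, x \notin s.
Variables (mu : seq nat) (b : nat).
Hypothesis mu_sorted : sorted geq mu.
Notation mu' := (plus_first b mu).
Notation m := (ncols mu).
Notation W := (Weyl K n mu).
Notation W' := (Weyl K n mu').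
Notation ones := (ones n' b).
Notation phi := (@phi K n' mu b).

(** The terms of [sum_raise0] are grouped by the size [q] of [s]. The empty set gives the right-hand
    side; for [0 < q < p ^ d] there are ['C(b, q)] equal terms, and this number is zero in [K]; for
    larger [q] the weight makes every term vanish. *)
Lemma phi_raise0 p d la w : p \in [pchar K] -> (p ^ d %| b)%N ->
  (minn (nth 0 la 1) (nth 0 mu 0 - nth 0 la 0) < p ^ d)%N ->
  w \in W' -> (forall S, w S != 0 -> forall i, mult S i = nth 0%N (plus_first b la) i) ->
  phi (act K n mu' (raise K n' 0) w) = act K n mu (raise K n' 0) (phi w).
Proof.
move=> pK /dvdnP[k bE] small wW wt; have pr_p := pcharf_prime pK.
apply/ffunP => A; rewrite ffunE !actE.
(* For [n = 1] the matrix [raise K n' 0] is the identity. *)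
have [n1|n1] := ltnP 1 n; last first.
  have e : raise K n' 0 = 1%:M.
    apply/matrixP => x y; rewrite !mxE; congr (_%:R); case: (x == y) => //=.
    by have := leq_trans (ltn_ord y) n1; case: eqP => //= _; case: (y : nat).
  by rewrite e !gact1 ffunE.
pose x := Ordinal n1; have x1 : x = 1%N :> nat by [].
have x0 : x != ord0 by [].
rewrite gact_ext (sum_raise0 _ x1) (bigD1 set0) //= points0.
transitivity (gact (raise K n' 0) (fun A' => w (ext A' ones)) A + 0); last first.
  by rewrite addr0; apply: eq_gact => A'; rewrite ffunE.
congr (_ + _).
rewrite (partition_big (fun s : {set 'I_b} => inord #|s| : 'I_b.+1) xpredT) //=.
apply: big1 => q _; pose F s := gact (raise K n' 0) (fun A' => w (ext A' (points x s))) A.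
have inordE (s : {set 'I_b}) : (inord #|s| == q) = (#|s| == q :> nat).
  by rewrite -val_eqE /= inordK // ltnS -[X in (_ <= X)%N]card_ord max_card.
have [q0|q0] := posnP q.
  rewrite big_pred0 // => s; rewrite inordE q0 cards_eq0.
  by case: eqP.
have [qd|qd] := leqP (p ^ d) q.
  rewrite big1 // => s /andP[_]; rewrite inordE => /eqP cs.
  (* A nonzero coordinate would give [q <= nth 0 la 1] from the multiplicity of [x], and
     [nth 0 la 0 + q <= nth 0 mu 0] from that of [ord0], since [A'] has only [nth 0 mu 0]
     columns. *)
  rewrite /gact big1 // => A' _; have [->|ne] := eqVneq (w (ext A' (points x s))) 0.
    by rewrite mulr0.
  have := wt _ ne x; have := wt _ ne ord0.
  rewrite !mult_ext mult_points // !nth_plus_first cs mul0n addn0 mul1n /= -cs.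
  have := mult_points0 s x0; have : (mult A' ord0 <= nth 0 mu 0)%N by apply: leq_mult.
  by move=> *; exfalso; move: (p ^ d)%N small qd => P; lia.
rewrite (eq_bigl (fun s => s \in [set s : {set 'I_b} | #|s| == q])); last first.
  move=> s; rewrite inordE inE -cards_eq0.
  by case: (eqVneq #|s| q) => [->|_]; rewrite ?andbF // andbT -lt0n.
have [s0 /eqP cs0|none] := pickP (fun s : {set 'I_b} => #|s| == q); last first.
  by rewrite big_pred0 // => s; rewrite inE none.
rewrite (eq_bigr (fun=> F s0)) => [|s]; last first.
  rewrite inE => /eqP cs; apply: eq_gact => A'.
  by apply: Weyl_points => //; rewrite cs cs0.
rewrite sumr_const card_draws card_ord -mulr_natr.
have /dvdnP[c ->] : (p %| 'C(b, q))%N.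
  have : (0 < (q : nat) < p ^ d)%N by rewrite q0.
  by move: (q : nat) => q'; rewrite bE; apply: dvdn_bin_pfactor.
by rewrite natrM (pcharf0 pK) !mulr0.
Qed.

(** Column 0 of an upper triangular matrix vanishes below row 0, so a column set of [T] containing 0
    forces the corresponding one of [S] to contain 0. *)
Lemma mult_raise i (S T : tidx n mu') :
  \prod_j gminor (raise K n' i) (S j) (T j) != 0 -> (mult T ord0 <= mult S ord0)%N.
Proof.
move/prodf_neq0 => nz; apply: subset_leq_card; apply/subsetP => j; rewrite !inE => T0.
apply: contraT => S0; have /negP := nz j isT; case; apply/eqP.
apply: (gminor_col0 T0) => x xS; apply: raise_tri.
rewrite lt0n; apply: contraNneq S0 => x0.
by rewrite (_ : ord0 = x) //; apply: val_inj.
Qed.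

(** Induction on the number [Q S] of columns in [A0] without 0. If there are none, the last [b]
    columns are singletons 0 and the coordinate is one of [phi w]. Otherwise an exchange with a
    column outside [A0] expresses [w S] through coordinates with smaller [Q]. *)
Lemma phi_inj w : w \in W' ->
  (forall S, w S != 0 -> (nth 0 mu 1 + b <= mult S ord0)%N) -> phi w = 0 -> w = 0.
Proof.
move=> wW big phi0.
(* The columns of length at least two together with the added ones; every column outside [A0] has
   length one. *)
pose A0 := [set j : 'I_(m + b) | (j < nth 0 mu 1)%N || (m <= j)%N].
have mu10 : (nth 0 mu 1 <= m)%N by apply: nth_sorted_geq.
have cA0 : #|A0| = (nth 0 mu 1 + b)%N.
  rewrite -sum1_card big_mkcond big_split_ord /=; congr (_ + _)%N.
    rewrite -big_mkcond (eq_bigl (fun a : 'I_m => (a < nth 0 mu 1)%N)) => [|a].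
      by rewrite (big_ord_narrow mu10) sum1_card card_ord.
    by rewrite inE /= [(m <= a)%N]leqNgt ltn_ord orbF.
  by rewrite (eq_bigr (fun=> 1%N)) ?sum1_card ?card_ord // => c _; rewrite inE /= leq_addr orbT.
pose Q (S : tidx n mu') := #|[set j in A0 | ord0 \notin S j]|.
suff main q S : (Q S < q)%N -> w S = 0.
  by apply/ffunP => S; rewrite [RHS]ffunE; apply: (main (Q S).+1).
elim: q S => // q IH S QS; apply/eqP; apply: contraT => wS.
have cS j : #|S j| = #|hwidx n' mu' j|.
  by apply/eqP; apply: contraNT wS => ne; apply/eqP/(Weyl_card Kinf wW ne).
have [Q0|] := eqVneq (Q S) 0%N.
  have in0 j : j \in A0 -> ord0 \in S j.
    move=> jA; apply: contraT => nin; move/eqP: Q0; rewrite cards_eq0 => /eqP/setP/(_ j).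
    by rewrite !inE nin andbT -[X in X = _ -> _]/(_ || _); move: jA; rewrite inE => ->.
  have SE : S = ext [ffun a => S (lshift b a)] ones.
    rewrite -[LHS](@ext_eta n' m b); congr (ext _ _); apply/ffunP => c.
    rewrite !ffunE; apply/esym/eqP; rewrite eqEcard sub1set in0 ?inE /= ?leq_addr ?orbT //=.
    by rewrite cS (hwidx_plus _ _ mu_sorted) ext_r ffunE.
  have /ffunP/(_ [ffun a => S (lshift b a)]) := phi0.
  by rewrite !ffunE -SE => /eqP; rewrite (negPf wS).
rewrite -lt0n card_gt0 => /set0Pn[c]; rewrite inE => /andP[cA c0].
(* At least [#|A0|] columns contain 0 by weight, and [c] in [A0] does not, so some column outside
   [A0] does. *)
have [c' c'A c'0] : exists2 c', c' \notin A0 & ord0 \in S c'.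
  have [c' /andP[? ?]|none] := pickP (fun c' => (c' \notin A0) && (ord0 \in S c')).
    by exists c'.
  have := big _ wS; rewrite -cA0 leqNgt => /negP; case.
  apply: proper_card; apply/properP; split.
    apply/subsetP => j; rewrite inE => S0; have := none j; rewrite S0 andbT.
    by move/negbFE.
  by exists c => //; rewrite inE.
have cc' : c != c' by apply: contraNneq c'A => <-.
have hwc : ord0 \in hwidx n' mu' c by rewrite ffunE inE ltn_ord.
have hwc' : hwidx n' mu' c' = [set ord0].
  move: c'A; rewrite inE negb_or -leqNgt -ltnNge => /andP[ge lt].
  apply/setP => i; rewrite ffunE !inE nth_plus_first -val_eqE /=.
  case: ((i : nat) =P 0%N) => [->|/eqP i0].
    by rewrite mul1n ltn_addr.
  rewrite addn0; apply/negbTE; rewrite -leqNgt; apply: leq_trans ge.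
  by apply: nth_sorted_geq; rewrite // lt0n.
have S1 : S c' = [set ord0].
  by apply/esym/eqP; rewrite eqEcard sub1set c'0 cS hwc' leqnn.
have U0 : ord0 \in ord0 |: S c by rewrite setU11.
(* The term at [ord0] is [w S] up to sign; every other term puts 0 into column [c], and the only
   column that loses it is [c'], outside [A0]. *)
have := Weyl_exchange Kinf S (ord0 |: S c) wW cc' hwc hwc'.
rewrite (bigD1 ord0) //= [X in _ + X]big1 ?addr0 => [|x /andP[xU x0]].
  have -> : upd S c c' ((ord0 |: S c) :\ ord0) [set ord0] = S.
    apply/ffunP => j; rewrite ffunE; case: eqP => [->|_]; first by rewrite setU1K.
    by case: eqP => [->|].
  by move/eqP; rewrite mulf_eq0 signr_eq0 (negPf wS).
rewrite IH ?mulr0 //; apply: leq_trans (QS : (Q S <= q)%N).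
apply: proper_card; apply/properP; split; last first.
  exists c; first by rewrite inE cA c0.
  by rewrite inE cA ffunE eqxx !inE eq_sym x0 eqxx.
apply/subsetP => j; rewrite !inE => /andP[jA]; rewrite jA /= ffunE.
case: eqP => [->|_]; first by rewrite !inE eq_sym x0 eqxx.
by case: eqP => [e|//]; move: c'A; rewrite -e inE jA.
Qed.

Lemma Prim_lincomb (la nu : seq nat) a (u v : amb K n nu) :
  Prim la u -> Prim la v -> Prim la (a *: u + v).
Proof.
move=> [uW [uwt uinv]] [vW [vwt vinv]]; split; first by rewrite memvD ?memvZ.
split=> [S|i S].
  have [u0|u0 _] := eqVneq (u S) 0; last exact: uwt.
  by rewrite !ffunE u0 scaler0 add0r; apply: vwt.
have ui : act K n nu (raise K n' i) u = u by apply/ffunP => T; rewrite actE.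
have vi : act K n nu (raise K n' i) v = v by apply/ffunP => T; rewrite actE.
have e : act K n nu (raise K n' i) (a *: u + v) = a *: u + v.
  by rewrite act_is_linear ui vi.
by rewrite -[in RHS]e actE.
Qed.

Lemma sorted_plus_first (nu : seq nat) : sorted geq nu -> sorted geq (plus_first b nu).
Proof.
case: nu => [|x [|y s]] //= /andP[yx ->].
by rewrite andbT; apply: leq_trans yx (leq_addr _ _).
Qed.

(** The map [phi] restricts to an isomorphism between the spaces of primitive vectors. For
    surjectivity, a preimage of the right weight is primitive because [phi] kills its difference
    with its image under each raising matrix. *)
Lemma Prim_plus_first p d la : p \in [pchar K] -> (p ^ d %| b)%N ->
  (minn (nth 0 la 1) (nth 0 mu 0 - nth 0 la 0) < p ^ d)%N ->
  (nth 0 mu 1 <= nth 0 la 0)%N ->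
  forall e, has_dim K _ (@Prim K n' (plus_first b la) mu') e <->
    has_dim K _ (@Prim K n' la mu) e.
Proof.
move=> pK db small mu_la.
have phi_raise i w : w \in W' ->
    (forall S, w S != 0 -> forall i, mult S i = nth 0%N (plus_first b la) i) ->
    phi (act K n mu' (raise K n' i) w) = act K n mu (raise K n' i) (phi w).
  by case: i => [|i] wW wt; [apply: (phi_raise0 pK db small) | apply: phi_raise_pos].
have multS i (A : tidx n mu) :
    mult (ext A ones) i = nth 0%N (plus_first b la) i <-> mult A i = nth 0%N la i.
  have -> : mult (ext A ones) i = (mult A i + (i == 0 :> nat) * b)%N.
    rewrite mult_ext; congr (_ + _)%N; rewrite multE (eq_bigr (fun=> (i == 0 :> nat) : nat)).
      by rewrite sum_nat_const card_ord mulnC.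
    by move=> c _; rewrite ffunE inE.
  by rewrite nth_plus_first; split=> [/addIn|->].
have big_wt (w : amb K n mu') :
    (forall S, w S != 0 -> forall i, mult S i = nth 0%N (plus_first b la) i) ->
    forall S : tidx n mu', w S != 0 -> (nth 0 mu 1 + b <= mult S ord0)%N.
  by move=> wt S /wt ->; rewrite nth_plus_first mul1n leq_add2r.
apply: (@has_dim_iso _ _ _ _ _ phi) => /=.
- split; first exact: mem0v.
  split=> [S|i S]; first by rewrite ffunE eqxx.
  by rewrite /gact big1 ?ffunE // => T _; rewrite ffunE mulr0.
- by move=> a u v; apply: Prim_lincomb.
- move=> w [wW [wt inv]]; split; first exact: phi_Weyl.
  split=> [S|i S]; first by rewrite ffunE => /wt wtS i; apply/multS.
  have e : act K n mu (raise K n' i) (phi w) = phi w.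
    rewrite -phi_raise //; congr (phi _); apply/ffunP => T.
    by rewrite actE.
  by rewrite -[in RHS]e actE.
- move=> w [wW [wt inv]]; apply: phi_inj => //; exact: big_wt.
move=> v [vW [wt inv]]; have [w0 w0W phi0] := phi_onto Kinf b mu_sorted vW.
(* The preimage is cut down to its component of weight [plus_first b la]; [phi] still maps it to
   [v], as the discarded coordinates correspond to zero coordinates of [v]. *)
pose w := wproj [multinom nth 0%N (plus_first b la) i | i < n] w0.
have wW : w \in W' by apply: mem_wproj.
have wwt S : w S != 0 -> forall i, mult S i = nth 0%N (plus_first b la) i.
  rewrite ffunE; case: (multmon S =P _) => [/mnmP e _ i|_]; last by rewrite eqxx.
  by have := e i; rewrite !mnmE.
have phiw : phi w = v.
  rewrite -phi0; apply/ffunP => A; rewrite !ffunE; case: (multmon _ =P _) => // ne.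
  have vA : v A = w0 (ext A ones) by rewrite -phi0 ffunE.
  apply/eqP; rewrite eq_sym -vA; apply: contraT => vA0; case: ne.
  by apply/mnmP => i; rewrite !mnmE; apply/multS/wt.
exists w => //; split=> //; split=> // i S.
suff : act K n mu' (raise K n' i) w - w = 0.
  by move/eqP; rewrite subr_eq0 => /eqP e; rewrite -[in RHS]e actE.
apply: phi_inj.
- by rewrite memvB // Weyl_stable.
- have subE (u u' : amb K n mu') T : (u - u') T = u T - u' T by rewrite !ffunE.
  move=> T; rewrite subE actE.
  have [wT|wT _] := eqVneq (w T) 0; last exact: (big_wt w wwt T wT).
  rewrite wT oppr0 addr0 => nz.
  (* A nonzero coordinate of the raised vector comes from a nonzero coordinate [w T'], and by
     [mult_raise] the multiplicity of 0 in [T] is at least that in [T']. *)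
  have [T' nz' | none] := pickP (fun T' : tidx n mu' =>
      (\prod_j gminor (raise K n' i) (T j) (T' j)) * w T' != 0).
    apply: leq_trans (mult_raise (i := i) _).
      by apply: (big_wt w wwt T'); move: nz'; rewrite mulf_eq0 negb_or => /andP[].
    by move: nz'; rewrite mulf_eq0 negb_or => /andP[].
  move/eqP: nz; case; rewrite /gact big1 // => T' _; apply/eqP/negbFE.
  exact: none.
- rewrite linearB /= phi_raise // phiw; apply/eqP; rewrite subr_eq0; apply/eqP.
  by apply/ffunP => A; rewrite actE inv.
Qed.

End Periodicity.

Local Close Scope ring_scope.

Theorem theorem2p1 (K : fieldType) (p : nat)
  (Hinf : forall s : seq K, exists x : K, x \notin s)
  (Hp : prime p) (Hchar : p \in [pchar K]%R)
  (n r : nat) (la mu : seq nat) (k d : nat)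
  (Hn : (0 < n)%N)
  (Hla : is_partition n r la) (Hmu : is_partition n r mu)
  (H21 : (nth 0 mu 1 <= nth 0 la 0)%N)
  (Hpd : (minn (nth 0 la 1) (nth 0 mu 0 - nth 0 la 0) < p ^ d)%N) :
  forall e : nat,
    dimHom_is K n la mu e <->
    dimHom_is K n (plus_first (k * p ^ d) la) (plus_first (k * p ^ d) mu) e.
Proof.
move=> e; case: n Hn Hla Hmu => // n' _ /and3P[_ sla _] /and3P[_ smu _].
rewrite !dimHom_Prim //; last exact: sorted_plus_first.
have db : (p ^ d %| k * p ^ d)%N by apply: dvdn_mull.
exact: iff_sym (Prim_plus_first n' Hinf smu Hchar db Hpd H21 e).
Qed.
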